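(* Let $I$ be a unit square in the plane and let $\Delta$ be an equilateral triangle with a side parallel to a side of $I$. Let $\{\Delta_n\}$ be a (finite or infinite) collection of homothetic copies of $\Delta$. If $\sum |\Delta_n| \le \frac{\sqrt{3}}{4}$, then the equilateral triangles from $\{\Delta_n\}$ can be parallel packed into $I$. Moreover, $\varrho(I,\Delta)=\frac{\sqrt{3}}{4}$.
   Context: For a plane convex body $C$, $|C|$ denotes its area. A homothetic copy of $C$ is an image of $C$ under a homothety (a scaling by a nonzero ratio followed by a translation). In the packings considered, both translations and $180^\circ$ rotations are allowed: a collection of polygons $\{C_n\}$ can be packed into a plane convex body $D$ if there exist maps $\lambda_n$, each being either a translation or a rotation by $180^\circ$ about some point of the plane, such that all the sets $\lambda_n C_n$ are subsets of $D$ and have pairwise disjoint interiors. The packing of a polygon $D$, one side of which is called its base, is called parallel if each $\lambda_n C_n$ has a side parallel to the base of $D$. Here the base of $I$ is a side of $I$ parallel to a side of $\Delta$; since the maps $\lambda_n$ preserve the directions of sides, the parallelism condition then holds automatically. For plane convex bodies $D$ and $C$, $\varrho(D,C)$ denotes the greatest number such that any collection of homothetic copies of $C$ with total area not greater than $\varrho(D,C)\cdot|D|$ can be parallel packed into $D$. *)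

(* Defs.v *)
From HB Require Import structures.
From mathcomp Require Import all_boot all_order all_algebra.
From mathcomp Require Import all_classical all_reals all_analysis.

Set Implicit Arguments.
Unset Strict Implicit.
Unset Printing Implicit Defensive.

Import Order.TTheory GRing.Theory Num.Theory.
Import numFieldNormedType.Exports.

Local Open Scope classical_set_scope.
Local Open Scope ring_scope.

(* The library norm on R * R is the max-norm (it induces the usual topology),
   so Euclidean lengths and angles go through [dot]. *)
Notation plane R := (R * R)%type.

Section Plane.
Context {R : realType}.
Implicit Types (u v x a b : plane R) (A C D : set (plane R)).

Definition dot u v : R := u.1 * v.1 + u.2 * v.2.

Definition enorm u : R := Num.sqrt (dot u u).

Definition parallel u v : Prop := u.1 * v.2 = u.2 * v.1.

Definition area A : \bar R :=
  (@lebesgue_measure R \x @lebesgue_measure R)%E A.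

Definition conv_hull (s : seq (plane R)) : set (plane R) :=
  [set x | exists w : 'I_(size s) -> R,
     [/\ forall i, 0 <= w i, \sum_i w i = 1 & x = \sum_i w i *: s`_i]].

Definition unit_square D : Prop :=
  exists p u v, [/\ enorm u = 1, enorm v = 1, dot u v = 0 &
    D = conv_hull [:: p; p + u; p + u + v; p + v]].

Definition equilateral_triangle D : Prop :=
  exists p q r, [/\ 0 < enorm (q - p), enorm (r - q) = enorm (q - p),
    enorm (p - r) = enorm (q - p) & D = conv_hull [:: p; q; r]].

(* [a, b] is a side of the convex polygon D: a nondegenerate segment cut out
   of D by a supporting line, with normal vector w. *)
Definition is_side D a b : Prop :=
  a <> b /\ exists w : plane R,
    [/\ w <> 0, forall x, D x -> dot w x <= dot w a &
        D `&` [set x | dot w x = dot w a] = conv_hull [:: a; b]].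

Definition homothetic_copy C A : Prop :=
  exists (k : R) (t : plane R), k <> 0 /\ A = [set k *: x + t | x in C].

Definition translation_or_half_turn (f : plane R -> plane R) : Prop :=
  (exists t, f = fun x => x + t) \/ (exists q, f = fun x => q *+ 2 - x).

(* A collection is a family indexed by a set N of natural numbers, finite or
   infinite: repetitions count, and values of T outside N are irrelevant. *)
Definition packing D (N : set nat) (T : nat -> set (plane R))
    (f : nat -> plane R -> plane R) : Prop :=
  [/\ forall n, N n -> translation_or_half_turn (f n),
      forall n, N n -> f n @` T n `<=` D &
      forall m n, N m -> N n -> m <> n ->
        interior (f m @` T m) `&` interior (f n @` T n) = set0].

(* The polygon D is taken with base [a, b]. *)
Definition parallel_packable D a b (N : set nat) (T : nat -> set (plane R)) :
    Prop :=
  exists f, packing D N T f /\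
    forall n, N n -> exists c d,
      is_side (f n @` T n) c d /\ parallel (d - c) (b - a).

Definition guarantees_parallel_packing D a b C (r : R) : Prop :=
  forall (N : set nat) (T : nat -> set (plane R)),
    (forall n, N n -> homothetic_copy C (T n)) ->
    (\esum_(n in N) area (T n) <= r%:E * area D)%E ->
    parallel_packable D a b N T.

(* r is rho(D, C), the greatest such number, D having base [a, b]. *)
Definition is_rho D a b C (r : R) : Prop :=
  guarantees_parallel_packing D a b C r /\
  ubound (guarantees_parallel_packing D a b C) r.

End Plane.

(* Main.v *)
Require Import Defs.
From HB Require Import structures.
From mathcomp Require Import all_boot all_order all_algebra.
From mathcomp Require Import all_classical all_reals all_analysis.
From mathcomp Require Import measurable_realfun ring lra.
Import Order.TTheory GRing.Theory Num.Theory.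
Import numFieldNormedType.Exports.
Local Open Scope classical_set_scope.
Local Open Scope ring_scope.

(** Why the theorem holds.

    Choose an orthonormal frame along the sides of the square whose first axis
    is parallel to the base. Every homothetic copy of the triangle has a side
    parallel to that axis, and if [s_n] is the length of the sides of the [n]-th
    copy, its area is [sqrt 3 / 4 * s_n ^ 2]; so the squares of the [s_n] add up
    to at most 1. Translations and half-turns carry a copy to any place, pointing
    up or down at will ([move_placed]). Only finitely many copies are at least
    as large as a given one, so that they can be enumerated by decreasing size even if there
    are infinitely many ([decreasing_enumeration]).

    The largest triangle, of side [a], is put into the lower left corner of the
    square, pointing up. What lies to the right of its right side contains a
    trapezoid with a slanted left side; if [a < 1 / sqrt 3], the slanted side is
    moved to the right until it passes through the upper left corner. This
    trapezoid is filled greedily with horizontal layers, from the top to the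
    bottom. A layer starts with a triangle pointing down that leans against the
    slanted side and determines the height of the layer; then triangles pointing
    up and down alternate, adjacent ones touching along their slanted sides,
    until the next triangle would cross the right side of the square. That one
    opens a new layer. Since a new layer is opened only when the previous one is
    full, complete layers contain a certain area ([invariant]), and if the layers
    needed more height than there is, the total area would exceed that of a
    triangle of side 1 ([capacity_gt]), against the assumption. The induction is [slots_invariant], and [place_separated]
    shows that any two of the triangles are separated by a line.

    The constant is optimal because a triangle of side longer than 1 with a side
    parallel to the base is wider than the square.

    All sets may be rotated with respect to the coordinate axes, so that the
    areas rest on the formula for the measure of an affine image
    ([scales_area_affine]). *)

(** * How much a stack of layers holds *)

Section Capacity.
Context {R : realFieldType}.
Implicit Types h a e D K S P T tau z : R.

(** A lower bound for the area in layers of total height [P], the first of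
    height [S] and the second of height [z], in a trapezoid of width [D] at its
    top. Areas are measured in units of the triangle of side 1 and heights in
    units of its altitude. A complete layer of width [W] that starts with a
    triangle of side [s] and is followed by a layer of height [s'] contains at
    least [s ^+ 2 - s' ^+ 2 + 2 * s' * (W - s)], where [W] is [D] minus half of
    the heights of the layers above. Adding this up, with the squares of all
    heights but the first two dropped and the products of consecutive heights
    estimated by means of [z], leaves this expression. *)
Definition later_bound S D P z : R :=
  3/2 * S ^+ 2 + 2 * D * (P - S) - P ^+ 2 / 2 + 3/2 * z ^+ 2 - z * P.

(** [later_bound] at its minimum [z = P / 3]. *)
Definition capacity S D P : R := 3/2 * S ^+ 2 + 2 * D * (P - S) - 2/3 * P ^+ 2.

Lemma capacity_le_later_bound S D P z : capacity S D P <= later_bound S D P z.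
Proof. have := sqr_ge0 (z - P / 3); rewrite /capacity /later_bound; nra. Qed.

Lemma later_bound_second_layer S D tau :
  later_bound S D (S + tau) tau = S ^+ 2 + 2 * tau * (D - S).
Proof. by rewrite /later_bound; field. Qed.

Lemma later_bound_next_layer S0 D S P T tau z : S <= z -> 0 <= tau ->
  later_bound S0 D P z <= T ->
  later_bound S0 D (P + tau) z <= T + 2 * tau * (D - P / 2 - S / 2).
Proof.
move=> Sz t0; rewrite /later_bound => HT.
have := sqr_ge0 tau; have : tau * S <= tau * z by rewrite ler_wpM2l.
nra.
Qed.

Lemma square_height_bounds h : 0 < h -> 3 * h ^+ 2 = 4 ->
  1154/1000 < h /\ h < 1155/1000.
Proof.
move=> h0 h2; have h1 : 1154/1000 < h by nra.
by split => //; nra.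
Qed.

(** Why total area 1 always suffices: if the layers used up the height [K], then
    together with the largest triangle, of side [a], they would contain more
    than that. Each hint is the square that remains after minimizing over one
    of the variables. *)
Lemma capacity_gt h a e D K S :
  0 < h -> 3 * h ^+ 2 = 4 -> D = 1 + h / 2 - e ->
  (e = a \/ (e = h / 2 /\ S <= a /\ 0 <= S)) ->
  (K = h \/ K = 3/2 * D) -> K <= h -> 1 < a ^+ 2 + capacity S D K.
Proof.
move=> h0 h2 -> He HK Kh; rewrite /capacity.
have [h1 h3] := square_height_bounds h h0 h2.
case: He HK => [->|[-> [Sa S0]]] [HK|HK]; rewrite ?HK.
- have := sqr_ge0 (a + S - h); have := sqr_ge0 (S - (2 - h)); nra.
- have := sqr_ge0 (S - 2/3 * (1 + h/2 - a)).
  have := sqr_ge0 (a - 5/11 * (1 + h/2)); nra.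
- have := sqr_ge0 (S - 2/5); nra.
- by rewrite HK in Kh; lra.
Qed.

Lemma first_layer_fits h a e S : 1154/1000 < h -> e = a \/ e = h / 2 ->
  a ^+ 2 + S ^+ 2 <= 1 -> S <= 1 + h / 2 - e.
Proof.
move=> h1 eP aS.
have [aS2 S1] : a + S <= 3/2 /\ S <= 1.
  by have := sqr_ge0 (a - S); split; rewrite leNgt; apply/negP => ?; nra.
by case: eP => ->; lra.
Qed.

Lemma second_layer_fits h a e S tau : 1154/1000 < h -> e = a \/ e = h / 2 ->
  S <= a -> 0 <= tau -> tau <= S -> a ^+ 2 + S ^+ 2 + tau ^+ 2 <= 1 ->
  e - h / 2 + S / 2 + tau <= 1.
Proof.
move=> h1 eP Sa tau0 tauS aSt.
have [sum1 sum2] : a + S / 2 + tau <= 3/2 /\ a + S + tau <= 2.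
  have s1 := sqr_ge0 (a / 2 - S); have s2 := sqr_ge0 (a - tau).
  have s3 := sqr_ge0 (S - tau / 2); have s4 := sqr_ge0 (a - S).
  have s5 := sqr_ge0 (S - tau).
  by split; rewrite leNgt; apply/negP => ?; nra.
by case: eP => ->; lra.
Qed.

End Capacity.

(** * Packing a decreasing sequence, layer by layer *)

Definition homothety {R : realFieldType} (k : R) (c b : R * R) : R * R :=
  (k * b.1 + c.1, k * b.2 + c.2).

(** An equilateral triangle with base from (0, 0) to (1, 0), in coordinates
    whose second axis is measured in units of the altitude; the sides have
    slope 2 and -2. *)
Definition base_triangle {R : realFieldType} (b : R * R) : Prop :=
  [/\ 0 <= b.2, b.2 / 2 <= b.1 & b.1 + b.2 / 2 <= 1].

Lemma base_triangle_scale {R : realFieldType} (s : R) b :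
  0 <= s -> base_triangle b ->
  [/\ 0 <= s * (b.1 - b.2 / 2), 0 <= s * (1 - b.1 - b.2 / 2) & 0 <= s * b.2].
Proof. by move=> s0 [? ? ?]; split; apply: mulr_ge0 => //; lra. Qed.

(** In the coordinates of [base_triangle] the square is
    [0 <= x <= 1], [0 <= y <= h] with [h = 2 / sqrt 3]. Triangles of sides
    [t 0 >= t 1 >= ...] are packed into its part [e <= x + y / 2], which lies to
    the right of a line of slope -2. *)
Section Layers.
Context {R : realFieldType}.
Variables (h e : R) (t : nat -> R).

(** The state when a triangle is about to be placed: the height of the top line
    of the current layer, the height of the layer, and the abscissa on the top
    line where the triangle goes: the left end of its horizontal side if it
    points down, its apex if it points up. *)
Record slot := Slot { top : R; height : R; cursor : R; pointing_up : bool }.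

Definition advance s (p : slot) : slot :=
  if pointing_up p then Slot (top p) (height p) (cursor p) false
  else Slot (top p) (height p) (cursor p + s) true.

Definition reach (p : slot) s : R :=
  if pointing_up p then cursor p + s / 2 else cursor p + s.

Definition next_slot s s' (p : slot) : slot :=
  if reach (advance s p) s' <= 1 then advance s p
  else Slot (top p - height p) s' (e - (top p - height p) / 2) false.

Fixpoint slots (n : nat) : slot :=
  if n is m.+1 then next_slot (t m) (t n) (slots m)
  else Slot h (t 0) (e - h / 2) false.

Variable a : R.
Hypothesis h_gt0 : 0 < h.
Hypothesis hh : 3 * h ^+ 2 = 4.
Hypothesis he : h / 2 <= e.
Hypothesis eP : e = a \/ e = h / 2.
Hypothesis a0 : t 0 <= a.
Hypothesis t_ge0 : forall n, 0 <= t n.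
Hypothesis t_dec : forall n, t n.+1 <= t n.
Hypothesis sumt : forall n, a ^+ 2 + \sum_(i < n) t i ^+ 2 <= 1.

Let D := 1 + h / 2 - e.
Let K := Num.min h (3/2 * D).

(** The current layer starts at abscissa [X] and ends at depth [P] below the top
    of the square. [T] bounds from below the area of the complete layers and of
    the first triangle of the current one; the later triangles of that layer
    come in pairs, pointing up and down, and are counted in terms of any lower
    bound [tau] of their sides, because they will be compared with the height of
    the layer that follows. The bound [3/2 * D] in [K] ensures that a triangle
    which opens a third or later layer fits into the width there, its side being
    at most a third of the depth that it reaches. *)
Definition invariant n (p : slot) (X P T : R) : Prop :=
  [/\ [/\ X = e - top p / 2, P = h - top p + height p, t n <= height p,
        height p <= t 0 & P <= K],
      [/\ X <= cursor p, X + height p <= cursor (advance (t n) p),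
        reach p (t n) <= 1 & X + height p <= 1],
      (forall tau, 0 <= tau -> tau <= t n ->
        T + tau * (2 * (cursor (advance (t n) p) - X - height p)
                   + (if pointing_up p then tau else 0))
        <= \sum_(i < n.+1) t i ^+ 2) &
      [/\ P = t 0, height p = t 0 & T = t 0 ^+ 2] \/
      (2 * height p <= P /\
       exists2 z, height p <= z & later_bound (t 0) D P z <= T)].

Let h_bounds := square_height_bounds _ h_gt0 hh.

Lemma sum_first : a ^+ 2 + t 0 ^+ 2 <= 1.
Proof. by have := sumt 1; rewrite big_ord_recl big_ord0 addr0. Qed.

Lemma sum_first_later n : a ^+ 2 + t 0 ^+ 2 + t n.+1 ^+ 2 <= 1.
Proof.
have := sumt n.+2; rewrite big_ord_recl big_ord_recr /=.
have : 0 <= \sum_(i < n) t (bump 0 i) ^+ 2 by apply: sumr_ge0 => i _; exact: sqr_ge0.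
by rewrite /bump /=; lra.
Qed.

Lemma invariant_first : exists X P T, invariant 0 (slots 0) X P T.
Proof.
exists (e - h / 2), (t 0), (t 0 ^+ 2).
have [h1 _] := h_bounds; have t0 := t_ge0 0.
have D0 : t 0 <= D := first_layer_fits h a e _ h1 eP sum_first.
have t01 : t 0 <= 1.
  by have := sum_first; have := sqr_ge0 a; rewrite leNgt => ? ?; apply/negP => ?; nra.
split => /=.
- split => //; first by ring.
  by rewrite /K le_min; apply/andP; split; lra.
- by rewrite /reach /=; split => //; move: D0; rewrite /D; lra.
- by move=> tau _ _; rewrite big_ord_recl big_ord0 /=; lra.
- by left.
Qed.

Lemma capacity_K : 1 < a ^+ 2 + capacity (t 0) D K.
Proof.
have Kh : K <= h by rewrite /K ge_min lexx.
apply: (capacity_gt h a e) => //.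
- by case: eP; [left|right; split => //; split => //; exact: t_ge0].
- by rewrite /K minEle; case: ifP => _; [left|right].
Qed.

(** If the new layer reached deeper than [K], then a layer of smaller height that
    ends exactly at [K] would satisfy the same estimate, against [capacity_K]. *)
Lemma layers_never_overflow n p X P T : invariant n p X P T ->
  1 < reach (advance (t n) p) (t n.+1) ->
  P + t n.+1 <= K /\
  T + 2 * t n.+1 * (1 - X - height p) <= \sum_(i < n.+2) t i ^+ 2.
Proof.
move=> [[EX EP tS S0 PK] [_ _ _ XS] HQ HT] over.
have tau0 := t_ge0 n.+1.
have HQ' := HQ _ tau0 (t_dec n).
have := sumt n.+2; have := capacity_K.
rewrite big_ord_recr /=; set tau := t n.+1 in tau0 over HQ' *.
set Q := \sum_(i < n.+1) _ in HQ' * => HK HS.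
have HQ2 : T + 2 * tau * (1 - X - height p) <= Q + tau ^+ 2.
  move: over HQ'; rewrite /reach /advance; case: (pointing_up p) => /=; nra.
split => //; rewrite leNgt; apply/negP => PK'.
pose tau' := K - P.
have t'0 : 0 <= tau' by rewrite subr_ge0.
have KE : K = P + tau' by rewrite /tau' addrC subrK.
have tt' : T + 2 * tau' * (1 - X - height p) <= Q + tau ^+ 2.
  apply: le_trans HQ2; rewrite lerD2l ler_wpM2r //; first by lra.
  by rewrite ler_pM2l // /tau'; lra.
have XE : 1 - X = D - P / 2 + height p / 2 by rewrite EX EP /D; lra.
suff : capacity (t 0) D K <= T + 2 * tau' * (1 - X - height p) by lra.
rewrite KE XE; case: HT => [[PE SE TE]|[_ [z Sz HT]]].
  apply: le_trans (capacity_le_later_bound _ _ _ tau') _.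
  by rewrite PE SE TE later_bound_second_layer; lra.
apply: le_trans (capacity_le_later_bound _ _ _ z) _.
apply: le_trans (later_bound_next_layer _ _ _ _ _ _ _ Sz t'0 HT) _; lra.
Qed.

Lemma invariant_same_layer n p X P T : invariant n p X P T ->
  reach (advance (t n) p) (t n.+1) <= 1 ->
  invariant n.+1 (advance (t n) p) X P T.
Proof.
have tau0 := t_ge0 n.+1; have tt := t_dec n; have tn := t_ge0 n.
move=> [[EX EP tS S0 PK] [Xc Xn _ XS] HQ HT].
move: HQ EX EP tS S0 PK Xc Xn XS HT; rewrite /reach /advance.
case: p => y S x [] /= HQ EX EP tS S0 PK Xc Xn XS HT fits.
- split => //=; [by split => //; lra|by split => //; lra|].
  move=> tau t0 t1; rewrite big_ord_recr /=.
  have := HQ _ t0 (le_trans t1 tt); move: (\sum_(i < n.+1) _) => Q.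
  by have := sqr_ge0 (t n.+1 - tau); lra.
- split => //=; [by split => //; lra|by split => //; lra|].
  move=> tau t0 t1; rewrite big_ord_recr /=.
  have := HQ _ t0 (le_trans t1 tt); move: (\sum_(i < n.+1) _) => Q.
  have : tau ^+ 2 <= t n.+1 ^+ 2 by rewrite lerXn2r // nnegrE.
  by lra.
Qed.

Lemma invariant_new_layer n p X P T : invariant n p X P T ->
  1 < reach (advance (t n) p) (t n.+1) ->
  let X' := e - (top p - height p) / 2 in
  invariant n.+1 (Slot (top p - height p) (t n.+1) X' false)
    X' (P + t n.+1) (T + 2 * t n.+1 * (1 - X - height p)).
Proof.
move=> inv over X'; have [PK HQ] := layers_never_overflow _ _ _ _ _ inv over.
case: inv => [[EX EP tS S0 _] [_ _ _ XS] _ HT] {over}.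
have S_ge0 : 0 <= height p := le_trans (t_ge0 n) tS.
have t0 := t_ge0 n.+1; have tS' : t n.+1 <= height p := le_trans (t_dec n) tS.
have t0' : t n.+1 <= t 0 := le_trans tS' S0.
have PE' : P + t n.+1 = h - (top p - height p) + t n.+1 by rewrite EP; ring.
have XE : 1 - X = D - P / 2 + height p / 2 by rewrite EX EP /D; lra.
have X'E : X' = e - h / 2 + P / 2 by rewrite /X' EP; lra.
have fits : X' + t n.+1 <= 1.
  rewrite X'E; case: HT => [[-> _ _]|[SP _]].
    exact: (second_layer_fits h a e _ _ h_bounds.1 eP a0 _ t0' (sum_first_later n)).
  have : P + t n.+1 <= 3/2 * D by move: PK; rewrite /K le_min => /andP[].
  by rewrite /D; lra.
split => /=.
- by split.
- by rewrite /reach /= -/X'; split.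
- move=> s _ _; rewrite -/X'; have -> : X' + t n.+1 - X' - t n.+1 = 0 by ring.
  by rewrite addr0 mulr0 mulr0 addr0.
right; rewrite XE; case: HT => [[PE SE TE]|[SP [z Sz HT]]].
  split; first by rewrite mulr_natl mulr2n lerD2r PE.
  exists (t n.+1) => //; rewrite PE SE TE later_bound_second_layer.
  by rewrite le_eqVlt; apply/orP; left; apply/eqP; field.
split; first by rewrite mulr_natl mulr2n lerD2r; lra.
exists z; first exact: le_trans tS' Sz.
apply: le_trans (later_bound_next_layer _ _ _ _ _ _ _ Sz t0 HT) _.
by rewrite le_eqVlt; apply/orP; left; apply/eqP; field.
Qed.

Lemma slots_invariant n : exists X P T, invariant n (slots n) X P T.
Proof.
elim: n => [|n [X [P [T inv]]]]; first exact: invariant_first.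
rewrite /= /next_slot; case: leP => [fits|over].
  by exists X, P, T; exact: invariant_same_layer.
by do 3 eexists; exact: invariant_new_layer inv over.
Qed.

(** For a triangle pointing up: where the line of slope -2 through its lower
    left vertex meets the top line of the layer. *)
Definition left_end (s : R) p := if pointing_up p then cursor p - s else cursor p.

(** The triangle of side [s] in the slot [p] is the image of [base_triangle]
    under the homothety of ratio [orient s p] that sends (0, 0) to [anchor s p],
    its lower left or upper right vertex. *)
Definition orient (s : R) p := if pointing_up p then s else - s.

Definition anchor (s : R) p :=
  if pointing_up p then (cursor p - s / 2, top p - s) else (cursor p + s, top p).

Definition place (s : R) p := homothety (orient s p) (anchor s p).

Lemma place_in_trapezoid n b : base_triangle b ->
  let z := place (t n) (slots n) b in
  [/\ 0 <= z.1, z.1 <= 1, 0 <= z.2, z.2 <= h & e <= z.1 + z.2 / 2].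
Proof.
move=> hb /=.
have [X [P [T [[EX EP tS S0 PK] [Xc Xn cr XS] _ HT]]]] := slots_invariant n.
have t0 := t_ge0 n.
have SP : height (slots n) <= P.
  by case: HT => [[-> -> _]|[? _]]; lra.
have Ph : P <= h by move: PK; rewrite /K le_min => /andP[].
have he' := he.
have [tb1 tb2 tb3] := base_triangle_scale _ _ t0 hb.
move: Xn cr; rewrite /place /homothety /orient /anchor /reach /advance.
case: (slots n) EX EP tS S0 Xc XS SP {HT} => y S x [] /= EX EP tS S0 Xc XS SP Xn cr.
  by split; lra.
by split; lra.
Qed.

(** The triangle [j] lies below the layer of [i], or in the same layer beyond the
    right side of [i]. That side has slope -2 and goes through the apex if [i]
    points up, and has slope 2 otherwise. *)
Definition after i j :=
  top (slots j) <= top (slots i) - height (slots i) \/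
  [/\ top (slots j) = top (slots i), height (slots j) = height (slots i) &
      cursor (advance (t i) (slots i)) <=
      if pointing_up (slots i) then left_end (t j) (slots j)
      else cursor (slots j)].

Lemma slots_after i j : (i < j)%N -> after i j.
Proof.
elim: j => // j IHj; rewrite ltnS leq_eqVlt => /orP[/eqP <-|/IHj].
  rewrite /after /= /next_slot; case: (leP (reach _ _)) => _ /=; last by left.
  right; rewrite /advance /left_end; have := t_dec i.
  by case: (slots i) => y S x [] /= ti; split => //; lra.
have [X [P [T [[_ _ tS _ _] _ _ _]]]] := slots_invariant j.
have := t_dec j; have := t_ge0 j.+1.
rewrite /after /= /next_slot; move: (slots i) (slots j) tS => p q tS t0 tt.
case: (leP (reach _ _)) => _ /= [below|[Ey ES c]].
- by left; move: below; rewrite /advance; case: (pointing_up q).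
- right; move: c; rewrite /advance /left_end.
  by case: (pointing_up q) (pointing_up p) => [] [] /=; split => //; lra.
- by left; lra.
- by left; rewrite Ey ES.
Qed.

Lemma place_separated i j : (i < j)%N ->
  exists w g, w <> (0, 0) :> R * R /\
    forall b b', base_triangle b -> base_triangle b' ->
    let z := place (t i) (slots i) b in let z' := place (t j) (slots j) b' in
    w.1 * z.1 + w.2 * z.2 <= g /\ g <= w.1 * z'.1 + w.2 * z'.2.
Proof.
move=> ij.
have [X [P [T [[_ _ tS _ _] _ _ _]]]] := slots_invariant i.
have t0 := t_ge0 i; have tj0 := t_ge0 j.
have := slots_after i j ij; rewrite /after.
move: (slots i) (slots j) tS => [y S x up] [y' S' x' up'] /= tS.
case=> [below|[Ey ES c]].
  exists (0, -1), (- (y - S)); split.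
    by move=> /(congr1 snd) /=; lra.
  move=> b b' /(base_triangle_scale _ _ t0) [b0 b1 b2].
  move=> /(base_triangle_scale _ _ tj0) [b'0 b'1 b'2].
  by rewrite /place /homothety /orient /anchor; split; [case: up|case: up'] => /=; lra.
have e1 (r : R) : (1, r) <> (0, 0) :> R * R by move=> /(congr1 fst) /=; lra.
case: up c => c;
  [exists (1, 1/2), (x + y / 2)|exists (1, -1/2), (x + t i - y / 2)];
  split => // b b' /(base_triangle_scale _ _ t0) [b0 b1 b2];
  move=> /(base_triangle_scale _ _ tj0) [b'0 b'1 b'2];
  move: c; rewrite /left_end /advance /place /homothety /orient /anchor /=;
  case: up' => /= c; split; lra.
Qed.

End Layers.

(** The largest triangle goes to the lower left corner, and the others into the
    trapezoid whose slanted side extends the right side of the largest one or,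
    if that line leaves the square through its left side, is the parallel line
    through the upper left corner. *)
Lemma packing_of_sequence {R : realFieldType} (h : R) (s : nat -> R) :
  0 < h -> 3 * h ^+ 2 = 4 ->
  (forall n, 0 <= s n) -> (forall n, s n.+1 <= s n) ->
  (forall n, \sum_(i < n) s i ^+ 2 <= 1) ->
  exists (k : nat -> R) (c : nat -> R * R),
    [/\ forall n, k n = s n \/ k n = - s n,
      forall n b, base_triangle b -> let z := homothety (k n) (c n) b in
        [/\ 0 <= z.1, z.1 <= 1, 0 <= z.2 & z.2 <= h] &
      forall i j, (i < j)%N -> exists w g, w <> (0, 0) :> R * R /\
        forall b b', base_triangle b -> base_triangle b' ->
        let z := homothety (k i) (c i) b in let z' := homothety (k j) (c j) b' in
        w.1 * z.1 + w.2 * z.2 <= g /\ g <= w.1 * z'.1 + w.2 * z'.2].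
Proof.
move=> h0 hh s0 sdec sumS.
pose t n := s n.+1; pose e := Num.max (s 0) (h / 2).
have ae : s 0 <= e by rewrite le_max lexx.
have he : h / 2 <= e by rewrite le_max lexx orbT.
have eP : e = s 0 \/ e = h / 2 by rewrite /e maxEle; case: ifP; [right|left].
have t0 n : 0 <= t n by exact: s0.
have tdec n : t n.+1 <= t n by exact: sdec.
have sumt n : s 0 ^+ 2 + \sum_(i < n) t i ^+ 2 <= 1.
  by have := sumS n.+1; rewrite big_ord_recl.
have [h1 h2] := square_height_bounds h h0 hh.
have s01 : s 0 <= 1.
  have := sumt 0; rewrite big_ord0 => ?; rewrite leNgt; apply/negP => ?; nra.
have trapezoid := place_in_trapezoid h e t _ h0 hh he eP (sdec 0) t0 tdec sumt.
have separated := place_separated h e t _ h0 hh eP (sdec 0) t0 tdec sumt.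
pose p n := slots h e t n.
exists (fun n => if n is m.+1 then orient (t m) (p m) else s 0).
exists (fun n => if n is m.+1 then anchor (t m) (p m) else (0, 0)).
have first_triangle b := base_triangle_scale (s 0) b (s0 0).
split.
- case=> [|m]; first by left.
  by rewrite /orient; case: ifP; [left|right].
- case=> [|m] b hb; last by case: (trapezoid m b hb) => ? ? ? ? _.
  have [? ? ?] := first_triangle b hb; split; rewrite /homothety /= ?addr0;
    clear trapezoid separated; lra.
- case=> [|i] [|j] // ij; last exact: separated.
  exists (1, 1/2), e; split; first by move=> /(congr1 fst) /=; lra.
  move=> b b' hb hb'; have [? ? ?] := first_triangle b hb.
  have [_ _ _ _] := trapezoid j b' hb'.
  by rewrite /place /homothety /= => ?; clear trapezoid separated; split; lra.
Qed.

(** * Enumerating the triangles by decreasing size *)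

(** Only finitely many sides exceed a given positive bound, so that repeatedly
    removing a largest triangle eventually reaches each of them. *)
Section Enumeration.
Context {R : realType}.
Variables (N : set nat) (s : nat -> R).
Hypothesis s_gt0 : forall n, N n -> 0 < s n.
Hypothesis sum_le1 : forall r : seq nat, uniq r -> {in r, forall n, N n} ->
  \sum_(n <- r) s n ^+ 2 <= 1.

Lemma large_bounded e : 0 < e -> exists M, forall n, N n -> e <= s n -> (n < M)%N.
Proof.
move=> e0; apply: contrapT => /forallNP unbounded.
have long K : exists r, [/\ uniq r, size r = K & {in r, forall n, N n /\ e <= s n}].
  elim: K => [|K [r [ur sr Nr]]]; first by exists [::].
  have /existsNP[n /not_implyP[Nn /not_implyP[en /negP]]] := unbounded (\max_(i <- r) i).+1.
  rewrite -leqNgt => rn; exists (n :: r); split=> /=; rewrite ?sr ?ur ?andbT //.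
    apply/negP => nr; have : (n <= \max_(i <- r) i)%N by exact: leq_bigmax_seq.
    by rewrite leqNgt rn.
  by move=> m; rewrite inE => /predU1P[-> //|/Nr].
have [r [ur sr Nr]] := long (Num.truncn (e ^- 2)).+1.
have := sum_le1 r ur (fun n nr => (Nr n nr).1); apply/negP; rewrite -ltNge.
apply: (@lt_le_trans _ _ (\sum_(n <- r) e ^+ 2)).
  rewrite big_const_seq count_predT sr iter_addr_0 -mulr_natl.
  rewrite -ltr_pdivrMr ?exprn_gt0 // mul1r.
  exact: truncnS_gt.
rewrite big_seq [leRHS]big_seq; apply: ler_sum => n /Nr[_ en].
by rewrite lerXn2r // nnegrE ltW // (lt_le_trans e0).
Qed.

Lemma max_exists (A : set nat) : A `<=` N -> A !=set0 ->
  exists n, A n /\ forall m, A m -> s m <= s n.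
Proof.
move=> AN [n0 An0]; have [M HM] := large_bounded (s n0) (s_gt0 _ (AN _ An0)).
have n0M := HM _ (AN _ An0) (lexx _).
case: (@arg_maxP _ _ _ (Ordinal n0M) (fun i : 'I_M => `[< A i >]) (fun i => s i)).
  by apply/asboolP.
move=> i /asboolP Ai Hi; exists i; split => // m Am.
have [mn0|n0m] := leP (s m) (s n0).
  by apply: le_trans mn0 _; apply: (Hi (Ordinal n0M)); apply/asboolP.
have mM := HM _ (AN _ Am) (ltW n0m).
by apply: (Hi (Ordinal mM)); apply/asboolP.
Qed.

Definition maximizer (A : set nat) : nat :=
  xget 0 [set n | A n /\ forall m, A m -> s m <= s n].

Fixpoint remaining k : set nat :=
  if k is j.+1 then remaining j `\ maximizer (remaining j) else N.

(** Padding with sides 0 turns a finite collection into an infinite sequence. *)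
Definition ranked k : R :=
  if `[< remaining k !=set0 >] then s (maximizer (remaining k)) else 0.

Lemma remaining_sub j k : (j <= k)%N -> remaining k `<=` remaining j.
Proof.
elim: k => [|k IHk]; first by rewrite leqn0 => /eqP ->.
rewrite leq_eqVlt => /predU1P[-> //|]; rewrite ltnS => /IHk H n /= [Hn _].
exact: H.
Qed.

Lemma maximizerP k : remaining k !=set0 ->
  remaining k (maximizer (remaining k)) /\
  forall m, remaining k m -> s m <= s (maximizer (remaining k)).
Proof.
move=> ne; have rN : remaining k `<=` N by exact: (remaining_sub 0 k (leq0n k)).
exact: (xgetPex 0%N (max_exists _ rN ne)).
Qed.

Lemma maximizer_inj j k : remaining j !=set0 -> remaining k !=set0 ->
  maximizer (remaining j) = maximizer (remaining k) -> j = k.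
Proof.
wlog jk : j k / (j < k)%N => [hw nj nk E|nj nk E].
  by case: (ltngtP j k) => // [jk|kj]; [|apply/esym]; apply: hw.
have [mk _] := maximizerP _ nk.
by have [_ []] := remaining_sub j.+1 k jk _ mk.
Qed.

Lemma rank_exists n : N n -> exists k, remaining k n /\ maximizer (remaining k) = n.
Proof.
move=> Nn; apply: contrapT => /forallNP no.
have all_k k : remaining k n.
  elim: k => // k IHk; split => // E; apply: (no k); split => //.
have ne k : remaining k !=set0 by exists n.
have [M HM] := large_bounded (s n) (s_gt0 _ Nn).
have mM k : (maximizer (remaining k) < M)%N.
  have [m1 m2] := maximizerP k (ne k); apply: HM; last exact: m2.
  exact: (remaining_sub 0 k (leq0n k)).
have : injective (fun k : 'I_M.+1 => Ordinal (mM k)).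
  by move=> i j [/maximizer_inj E]; apply/val_inj/E.
by move=> /leq_card; rewrite !card_ord ltnn.
Qed.

Lemma decreasing_enumeration : exists (rank : nat -> nat) (sigma : nat -> R),
  [/\ forall m n, N m -> N n -> rank m = rank n -> m = n,
      forall n, N n -> sigma (rank n) = s n,
      forall k, 0 <= sigma k /\ sigma k.+1 <= sigma k &
      forall k, \sum_(i < k) sigma i ^+ 2 <= 1].
Proof.
have ranked_ge0 k : 0 <= ranked k.
  rewrite /ranked; case: asboolP => // /maximizerP[+ _].
  by move=> /(remaining_sub 0 k (leq0n k)) /s_gt0/ltW.
have /choice[rank rankP] : forall n, exists k, N n ->
    remaining k n /\ maximizer (remaining k) = n.
  by move=> n; have [/rank_exists[k]|] := pselect (N n); [exists k|exists 0%N].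
exists rank, ranked; split => //.
- by move=> m n /rankP[_ {2}<-] /rankP[_ {2}<-] ->.
- move=> n /rankP[rn E]; rewrite /ranked E; case: asboolP => // -[].
  by exists n.
- move=> k; split => //; rewrite {1}/ranked; case: asboolP => // ne.
  have [/= [mk _] _] := maximizerP k.+1 ne.
  have nek : remaining k !=set0 by eexists; exact: mk.
  by rewrite /ranked; case: asboolP => // _; apply: (maximizerP k nek).2.
move=> K; pose r :=
  [seq maximizer (remaining k) | k <- iota 0 K & `[< remaining k !=set0 >]].
have -> : \sum_(i < K) ranked i ^+ 2 = \sum_(n <- r) s n ^+ 2.
  rewrite big_map big_filter -(big_mkord xpredT (fun i => ranked i ^+ 2)).
  rewrite /index_iota subn0.
  rewrite [RHS]big_mkcond /=; apply: eq_bigr => i _.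
  by rewrite /ranked; case: ifP => // _; rewrite expr0n.
apply: sum_le1.
  rewrite map_inj_in_uniq ?filter_uniq ?iota_uniq // => i j.
  rewrite !mem_filter => /andP[/asboolP ni _] /andP[/asboolP nj _].
  exact: maximizer_inj.
move=> n /mapP[k]; rewrite mem_filter => /andP[/asboolP nk _] ->.
by apply: (remaining_sub 0 k (leq0n k)); exact: (maximizerP k nk).1.
Qed.

End Enumeration.

(** * Affine maps scale the area by their determinant *)

(** Uniqueness theorems for measures apply to a bundled measure; this bundles a
    pushforward without naming its structure. *)
Lemma pushforward_is_measure {R : realType} d1 d2 (T1 : measurableType d1)
    (T2 : measurableType d2) (m : {measure set T1 -> \bar R}) (f : T1 -> T2) :
  measurable_fun [set: T1] f ->
  exists m' : {measure set T2 -> \bar R}, forall A, m' A = m (f @^-1` A).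
Proof.
move=> mf.
by unshelve refine
  (ex_intro _ (pushforward m f : {measure set T2 -> \bar R}) _).
Qed.

Section Area.
Context {R : realType}.
Local Notation mu := (@lebesgue_measure R).
Local Notation mR := (measurableTypeR R).

Lemma lebesgue_measure_affine_gt0 (k c : R) (A : set R) : 0 < k ->
  measurable (A : set mR) ->
  (k%:E * mu ((fun x : R => (k * x + c)%R) @^-1` A))%E = mu A.
Proof.
move=> k0 mA.
pose f := (fun x : mR => (k * x + c)%R : mR).
have mf : measurable_fun [set: mR] f.
  by apply: measurable_funD => //; exact: measurable_funM.
pose kn : {nonneg R} := NngNum (ltW k0).
have [m mE] := pushforward_is_measure _ _ _ _ mu f mf.
rewrite -mE.
change (mscale kn m A = mu A).
apply/esym/lebesgue_measure_unique => // _ [[a b]] _ <-.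
rewrite /= /mscale /= mE.
have -> : f @^-1` `]a, b] = `](a - c) / k, (b - c) / k]%classic.
  apply/seteqP; split => x /=; rewrite !in_itv /= /f ltr_pdivrMr //;
    by rewrite ler_pdivlMr // ltrBlDr lerBrDr mulrC.
apply: etrans (lebesgue_measure_itv `]a, b]) _.
apply: etrans (esym (congr1 (fun z => k%:E * z)%E
  (lebesgue_measure_itv `](a - c) / k, (b - c) / k]))).
rewrite /= !lte_fin ltr_pM2r ?invr_gt0 // ltrD2r.
case: ifP => _; last by rewrite mule0.
rewrite -!EFinB -EFinM; congr (_%:E); field; lra.
Qed.

Lemma measurable_affine_preimage (k c : R) (A : set R) :
  measurable (A : set mR) ->
  measurable ((fun x : R => (k * x + c)%R) @^-1` A : set mR).
Proof.
move=> mA; rewrite -[X in measurable X]setTI.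
by apply: measurable_funD => //; exact: measurable_funM.
Qed.

Lemma lebesgue_measure_affine (k c : R) (A : set R) : k != 0 ->
  measurable (A : set mR) ->
  (`|k|%:E * mu ((fun x : R => (k * x + c)%R) @^-1` A))%E = mu A.
Proof.
rewrite neq_lt => /orP[k0|k0] mA; last first.
  by rewrite gtr0_norm //; exact: lebesgue_measure_affine_gt0.
have k0' : 0 < - k by rewrite oppr_gt0.
rewrite ltr0_norm // -[RHS](lebesgue_measure_affine_gt0 (- k) c A) //.
congr (_ * _)%E.
rewrite -[RHS]lebesgue_measureN; last exact: measurable_affine_preimage.
by rewrite /pushforward; congr (mu _); apply/seteqP; split => x /=; rewrite mulrNN.
Qed.

(** The image of a set under an affine bijection is a preimage under the inverse,
    and preimages under compositions are easier to handle than images. *)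
Definition scales_area (f : plane R -> plane R) (k : R) : Prop :=
  forall A : set (mR * mR), measurable A ->
    measurable (f @^-1` A : set (mR * mR)) /\ (k%:E * area (f @^-1` A))%E = area A.

Lemma scales_area_comp f g k l : scales_area f k -> scales_area g l ->
  scales_area (f \o g) (k * l).
Proof.
move=> hf hg A /hf [mfA <-]; have [mgA <-] := hg _ mfA.
by rewrite EFinM muleA.
Qed.

Lemma scales_area_swap : scales_area (fun z => (z.2, z.1)) 1.
Proof.
pose f := (fun z : mR * mR => (z.2, z.1) : mR * mR).
have mf : measurable_fun [set: mR * mR] f.
  by apply: measurable_fun_pair.
move=> A mA; split; first by rewrite -[X in measurable X]setTI; exact: mf.
rewrite mul1e.
have [m mE] := pushforward_is_measure _ _ _ _ (mu \x mu)%E f mf.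
apply: etrans (esym (mE A)) _; apply/esym/product_measure_unique => // X Y mX mY.
rewrite mE.
rewrite (_ : f @^-1` (X `*` Y) = Y `*` X); last first.
  by apply/seteqP; split => -[x y] /= [].
by rewrite /= product_measure1E // muleC.
Qed.

Lemma scales_area_diag (k l a b : R) : k != 0 -> l != 0 ->
  scales_area (fun z => (k * z.1 + a, l * z.2 + b)) `|k * l|.
Proof.
move=> k0 l0.
pose f := (fun z : mR * mR => (k * z.1 + a, l * z.2 + b)%R : mR * mR).
have mf : measurable_fun [set: mR * mR] f.
  by apply: measurable_fun_pair; apply: measurable_funD => //; apply: measurable_funM.
move=> A mA; split; first by rewrite -[X in measurable X]setTI; exact: mf.
have [m mE] := pushforward_is_measure _ _ _ _ (mu \x mu)%E f mf.
pose kn : {nonneg R} := NngNum (normr_ge0 (k * l)).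
transitivity (mscale kn m A); first by rewrite /mscale mE.
apply/esym/product_measure_unique => // X Y mX mY.
rewrite /= /mscale /= mE.
rewrite -(lebesgue_measure_affine k a X) // -(lebesgue_measure_affine l b Y) //.
set P := _ @^-1` X; set Q := _ @^-1` Y.
have mP : measurable (P : set mR) by exact: measurable_affine_preimage.
have mQ : measurable (Q : set mR) by exact: measurable_affine_preimage.
transitivity (`|k * l|%:E * (mu P * mu Q))%E; last first.
  by rewrite normrM EFinM muleACA.
congr (_ * _)%E; exact: (product_measure1E mu mu).
Qed.

(** A shear translates each vertical section of a set. *)
Lemma scales_area_shear (k : R) : scales_area (fun z => (z.1, z.2 + k * z.1)) 1.
Proof.
pose f := (fun z : mR * mR => (z.1, z.2 + k * z.1)%R : mR * mR).
have mf : measurable_fun [set: mR * mR] f.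
  by apply: measurable_fun_pair => //; apply: measurable_funD => //; apply: measurable_funM.
move=> A mA; split; first by rewrite -[X in measurable X]setTI; exact: mf.
rewrite mul1e; apply: eq_integral => x _ /=.
rewrite -(lebesgue_measure_affine 1 (k * x) (xsection A x)) //; last first.
  exact: measurable_xsection.
rewrite normr1 mul1e; congr (mu _).
by apply/seteqP; split => y /xsectionP /= Ay; apply/xsectionP;
  rewrite /= ?mul1r // in Ay *.
Qed.

Definition det2 (u v : plane R) := u.1 * v.2 - u.2 * v.1.

(** An affine map whose matrix has a nonzero upper left entry is a composition of
    shears, scalings of the axes and a translation; exchanging the axes reduces
    the general case to this one. *)
Lemma scales_area_affine (u v t : plane R) : det2 u v != 0 ->
  scales_area (fun z => z.1 *: u + z.2 *: v + t) `|det2 u v|.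
Proof.
have main (p q r : plane R) : p.1 != 0 -> det2 p q != 0 ->
    scales_area (fun z => z.1 *: p + z.2 *: q + r) `|det2 p q|.
  move=> p1 d.
  pose shear_x k : plane R -> plane R := (fun z => (z.1 + k * z.2, z.2)).
  have shear_xP k : scales_area (shear_x k) 1.
    have := scales_area_comp _ _ _ _ scales_area_swap
      (scales_area_comp _ _ _ _ (scales_area_shear k) scales_area_swap).
    by rewrite !mulr1.
  have d1 : det2 p q / p.1 != 0 by rewrite mulf_neq0 // invr_eq0.
  have := scales_area_comp _ _ _ _
    (scales_area_diag 1 1 r.1 r.2 (oner_neq0 _) (oner_neq0 _))
    (scales_area_comp _ _ _ _ (scales_area_shear (p.2 / p.1))
      (scales_area_comp _ _ _ _ (scales_area_diag p.1 (det2 p q / p.1) 0 0 p1 d1)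
        (shear_xP (q.1 / p.1)))).
  rewrite (_ : _ * (_ * _) = `|det2 p q|); last first.
    by rewrite !mulr1 normr1 !mul1r [_ / _]mulrC mulVKf.
  congr (scales_area _ _); apply/funext => z.
  apply: injective_projections; rewrite /= /shear_x /det2 /GRing.scale /=; field; exact: p1.
move=> d; have [u1|u1] := eqVneq u.1 0; last exact: main.
have v1 : v.1 != 0.
  by apply: contraNneq d => v1; rewrite /det2 u1 v1 mul0r mulr0 subrr.
have dN : det2 v u = - det2 u v by rewrite /det2; ring.
have d' : det2 v u != 0 by rewrite dN oppr_eq0.
have := scales_area_comp _ _ _ _ (main v u t v1 d') scales_area_swap.
rewrite mulr1 dN normrN; congr (scales_area _ _).
by apply/funext => z /=; rewrite addrAC [_ + _ *: u]addrC addrA.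
Qed.

End Area.

(** * Convex hulls, and the areas of the square and of half of it *)

Section Hulls.
Context {R : realType}.
Implicit Types p q r u v t x : plane R.
Local Notation mu := (@lebesgue_measure R).
Local Notation mR := (measurableTypeR R).

Lemma conv_hull2P p q x : conv_hull [:: p; q] x <->
  exists k : R, [/\ 0 <= k, k <= 1 & x = (1 - k) *: p + k *: q].
Proof.
split=> [[w [w0]]|[k [k0 k1 ->]]].
  rewrite !big_ord_recl !big_ord0 /= !addr0 => w1 ->.
  exists (w (lift ord0 ord0)); split => //; last by rewrite -w1 addrK.
  by rewrite -w1 lerDr.
exists (fun i => [:: 1 - k; k]`_i); split.
- by case=> -[|[|//]] ? /=; rewrite ?subr_ge0.
- by rewrite !big_ord_recl !big_ord0 /= addr0 subrK.
- by rewrite !big_ord_recl !big_ord0 /= addr0.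
Qed.

Lemma conv_hull3P p q r x : conv_hull [:: p; q; r] x <->
  exists b c : R, [/\ 0 <= b, 0 <= c, b + c <= 1 &
    x = p + b *: (q - p) + c *: (r - p)].
Proof.
split=> [[w [w0]]|[b [c [b0 c0 bc ->]]]].
  rewrite !big_ord_recl !big_ord0 /= !addr0 => w1 ->.
  exists (w (lift ord0 ord0)), (w (lift ord0 (lift ord0 ord0))); split => //.
    by rewrite -w1 lerDr.
  move: w1; set a := w _; set b := w _; set c := w _ => w1.
  have -> : a = 1 - (b + c) by rewrite -w1 addrK.
  by apply: injective_projections; rewrite /= /GRing.scale /=; ring.
exists (fun i => [:: 1 - (b + c); b; c]`_i); split.
- by case=> -[|[|[|//]]] ? //=; rewrite subr_ge0.
- by rewrite !big_ord_recl !big_ord0 /= addr0 subrK.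
- rewrite !big_ord_recl !big_ord0 /= addr0.
  by apply: injective_projections; rewrite /= /GRing.scale /=; ring.
Qed.

Lemma conv_hull_squareP p u v x :
  conv_hull [:: p; p + u; p + u + v; p + v] x <->
  exists b c : R, [/\ 0 <= b <= 1, 0 <= c <= 1 & x = p + b *: u + c *: v].
Proof.
split=> [[w [w0]]|[b [c [/andP[b0 b1] /andP[c0 c1] ->]]]].
  rewrite !big_ord_recl !big_ord0 /= !addr0.
  have := w0 ord0; have := w0 (lift ord0 ord0).
  have := w0 (lift ord0 (lift ord0 ord0)).
  have := w0 (lift ord0 (lift ord0 (lift ord0 ord0))).
  set w1 := w _; set w2 := w _; set w3 := w _; set w4 := w _.
  move=> w10 w20 w30 w40 w1E ->.
  exists (w3 + w2), (w2 + w1); split; [lra|lra|].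
  have -> : w4 = 1 - (w3 + (w2 + w1)) by rewrite -w1E addrK.
  by apply: injective_projections; rewrite /= /GRing.scale /=; ring.
(* weights of a product: bilinear interpolation *)
exists (fun i => [:: (1 - b) * (1 - c); b * (1 - c); b * c; (1 - b) * c]`_i).
split.
- by case=> -[|[|[|[|//]]]] ? //=; apply: mulr_ge0; rewrite ?subr_ge0.
- by rewrite !big_ord_recl !big_ord0 /=; ring.
- rewrite !big_ord_recl !big_ord0 /= addr0.
  by apply: injective_projections; rewrite /= /GRing.scale /=; ring.
Qed.

Definition affine_frame u v t (z : plane R) := z.1 *: u + z.2 *: v + t.

Lemma area_affine_image u v t (A : set (mR * mR)) : det2 u v != 0 ->
  measurable A ->
  area (affine_frame u v t @` A) = (`|det2 u v|%:E * area A)%E.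
Proof.
move=> d mA.
pose d1 := (det2 u v)^-1.
pose u' : plane R := (d1 * v.2, - d1 * u.2).
pose v' : plane R := (- d1 * v.1, d1 * u.1).
pose g := affine_frame u' v' (- (t.1 *: u' + t.2 *: v')).
have fK : cancel (affine_frame u v t) g.
  move=> z; apply: injective_projections;
    rewrite /= /GRing.scale /= /d1 /det2; field; exact: d.
have gK : cancel g (affine_frame u v t).
  move=> z; apply: injective_projections;
    rewrite /= /GRing.scale /= /d1 /det2; field; exact: d.
have dg : det2 u' v' = d1 by rewrite /det2 /= /d1 /det2; field; exact: d.
have dg0 : det2 u' v' != 0 by rewrite dg invr_eq0.
have [_ gA] := scales_area_affine u' v' (- (t.1 *: u' + t.2 *: v')) dg0 A mA.
have -> : affine_frame u v t @` A = g @^-1` A.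
  apply/seteqP; split => [_ [z Az <-]|z gz]; first by rewrite /= fK.
  by exists (g z) => //; rewrite gK.
by rewrite -gA muleA -EFinM dg /d1 -normrM mulfV // normr1 mul1e.
Qed.

Lemma area_setX (X Y : set mR) : measurable X -> measurable Y ->
  area (X `*` Y) = (mu X * mu Y)%E.
Proof. exact: (product_measure1E mu mu). Qed.

Lemma area_setU (A B : set (mR * mR)) : measurable A -> measurable B ->
  A `&` B = set0 -> area (A `|` B) = (area A + area B)%E.
Proof. exact: (measureU (mu \x mu)%E). Qed.

Definition half_square : set (plane R) :=
  [set z | 0 <= z.2 /\ z.2 <= z.1 /\ z.1 <= 1].

Local Notation unit_box :=
  (`[0%R, 1%R]%classic `*` `[0%R, 1%R]%classic : set (mR * mR)).

Lemma area_unit_box : area unit_box = 1%E.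
Proof.
rewrite area_setX //.
have -> : mu `[0%R, 1%R]%classic = 1%E.
  by apply: etrans (lebesgue_measure_itv `[0%R, 1%R]) _; rewrite /= lte_fin ltr01 oppr0 adde0.
by rewrite mul1e.
Qed.

(** The unit box splits into its parts below and above the diagonal, which the
    exchange of the axes maps to each other, and the diagonal, which is a sheared
    segment of a horizontal line and hence null. *)
Lemma area_half_square : measurable (half_square : set (mR * mR)) /\
  area half_square = (1 / 2)%:E.
Proof.
pose f := (fun z : mR * mR => (z.1 - z.2)%R : mR).
have mf : measurable_fun [set: mR * mR] f by exact: measurable_funB.
have mfB (B : set mR) : measurable B -> measurable (f @^-1` B : set (mR * mR)).
  by move=> mB; rewrite -[X in measurable X]setTI; exact: mf.
have mbox : measurable unit_box by exact: measurableX.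
pose S : set (mR * mR) := unit_box `&` f @^-1` `]0%R, +oo[.
pose diag : set (mR * mR) := unit_box `&` f @^-1` [set 0%R].
have mS : measurable S by apply: measurableI => //; exact: mfB.
have mdiag : measurable diag by apply: measurableI => //; exact: mfB.
pose S' := ((fun z => (z.2, z.1)) @^-1` S : set (mR * mR)).
have [mS' aS'] := scales_area_swap S mS; rewrite mul1e -/S' in mS' aS'.
have adiag : area diag = 0%E.
  have -> : diag = affine_frame (1, 1) (0, 1) 0 @` (`[0%R, 1%R]%classic `*` [set 0%R]).
    have E (x : R) : affine_frame (1, 1) (0, 1) 0 (x, 0) = (x, x).
      by apply: injective_projections; rewrite /= /GRing.scale /=; ring.
    apply/seteqP; split => [[x y] /= [[]]|_ [[x y] /= [+ ->] <-]];
      rewrite /= ?E /f /= !in_itv /=.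
      move=> x01 _ /eqP; rewrite subr_eq0 => /eqP <-.
      by exists (x, 0); rewrite /= ?in_itv.
    by move=> x01; rewrite /diag /= !in_itv /f /= subrr.
  rewrite area_affine_image; last 2 first.
  - by rewrite /det2 /= mulr1 mulr0 subr0 oner_neq0.
  - exact: measurableX.
  rewrite (_ : area _ = 0%E) ?mule0 //.
  rewrite area_setX //.
  rewrite (_ : mu [set 0%R] = 0%E) ?mule0 //; exact: lebesgue_measure_set1.
have SD : S `&` diag = set0.
  apply/seteqP; split => // z [[_ /= +] [_ /= fz]].
  by rewrite fz in_itv /= ltxx.
have halfE : half_square = S `|` diag.
  apply/seteqP; split => [[x y] /= [y0 [xy x1]]|[x y] /= [[[]]|[[]]]];
    rewrite /S /diag /half_square /f /= !in_itv /= ?andbT.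
  - rewrite y0 x1 (le_trans y0 xy) (le_trans xy x1) subr_gt0.
    have [|yx|->] := ltgtP x y; [by move: xy; case: ltgtP|by left|by right; rewrite subrr].
  - move=> /andP[x0 x1] /andP[y0 y1]; rewrite subr_gt0 => /ltW yx.
    by rewrite y0 yx x1.
  - by move=> /andP[x0 x1] /andP[y0 y1] /eqP; rewrite subr_eq0 => /eqP <-.
have aSdiag : area half_square = area S.
  by rewrite halfE area_setU // adiag adde0.
have boxE : unit_box = half_square `|` S'.
  apply/seteqP; split => [[x y] /= []|[x y] /=];
    rewrite /S' /S /half_square /f /= !in_itv /= ?andbT.
  - move=> /andP[x0 x1] /andP[y0 y1]; rewrite x0 x1 y0 y1 subr_gt0.
    by have [xy|xy] := leP y x; [left|right].
  - case=> [[y0 [yx x1]]|[[/andP[y0 y1] /andP[x0 x1] _]]]; last by rewrite x0 x1 y0 y1.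
    by rewrite y0 x1 (le_trans y0 yx) (le_trans yx x1).
have HS' : half_square `&` S' = set0.
  apply/seteqP; split => // -[x y] /= [[y0 [yx x1]]]; rewrite /S' /S /f /= !in_itv /= andbT.
  by move=> [_]; rewrite subr_gt0 ltNge yx.
have mhalf : measurable (half_square : set (mR * mR)).
  by rewrite halfE; exact: measurableU.
split => //.
have := area_unit_box; rewrite boxE.
have -> : area (half_square `|` S') = (area half_square + area half_square)%E.
  by rewrite area_setU // {3}aSdiag -aS'.
have : (0 <= area half_square)%E by exact: (measure_ge0 (mu \x mu)%E).
case: (area half_square) => [r| |] //= _; rewrite -EFinD => -[E].
by congr (_%:E); lra.
Qed.

Lemma area_parallelogram p u v : det2 u v != 0 ->
  area (conv_hull [:: p; p + u; p + u + v; p + v]) = `|det2 u v|%:E.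
Proof.
move=> d; have := area_affine_image u v p unit_box d.
rewrite area_unit_box mule1 => <-; last exact: measurableX.
congr area; apply/seteqP; split => x.
  move=> /conv_hull_squareP[b [c [b01 c01 ->]]]; exists (b, c) => //.
  by rewrite /affine_frame /= addrC addrA.
move=> [[b c] [/= b01 c01] <-]; apply/conv_hull_squareP; exists b, c.
by rewrite !in_itv /= in b01 c01; split => //; rewrite /affine_frame /= addrC addrA.
Qed.

End Hulls.

(** * Sides of convex polygons *)

Section Sides.
Context {R : realType}.
Implicit Types (p q r u v w x y a b c d : plane R) (A B D : set (plane R)).

Lemma dotDr w x y : dot w (x + y) = dot w x + dot w y.
Proof. by rewrite /dot /=; ring. Qed.

Lemma dotZr w (k : R) x : dot w (k *: x) = k * dot w x.
Proof. by rewrite /dot /= /GRing.scale /=; ring. Qed.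

(** If the interiors had a common point, then moving from it a little in the
    direction [w] would stay in [A] but leave the half-plane that contains [A]. *)
Lemma interior_disjoint w (g : R) A B : w <> 0 ->
  (forall x, A x -> dot w x <= g) -> (forall x, B x -> g <= dot w x) ->
  interior A `&` interior B = set0.
Proof.
move=> w0 HA HB; apply/seteqP; split => // x [iA iB].
have Bx : B x by exact: nbhs_singleton.
have /nbhs_ballP[e /= e0 be] := iA.
have ww : 0 < dot w w.
  rewrite lt_neqAle eq_sym /dot; apply/andP; split; last by nra.
  apply/eqP => ww; apply: w0; apply: injective_projections => /=; nra.
pose m := 1 + `|w.1| + `|w.2|.
have m0 : 0 < m by rewrite /m; have := normr_ge0 w.1; have := normr_ge0 w.2; lra.
pose k := e / m.
have k0 : 0 < k by exact: divr_gt0.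
have small (z : R) : `|z| < m -> `|k * z| < e.
  by move=> zm; rewrite normrM gtr0_norm // /k -mulrA gtr_pMr // mulrC ltr_pdivrMr // mul1r.
have /HA : A (x + k *: w).
  apply: be; split; rewrite /ball /= opprD addrA subrr add0r normrN; apply: small;
  rewrite /m; have := normr_ge0 w.1; have := normr_ge0 w.2; lra.
rewrite dotDr dotZr; have := HB x Bx; have := mulr_gt0 k0 ww; lra.
Qed.

Lemma conv_hull_homothety (k : R) (t : plane R) p q :
  [set k *: x + t | x in conv_hull [:: p; q]] =
  conv_hull [:: k *: p + t; k *: q + t].
Proof.
apply/seteqP; split => [_ [x /conv_hull2P[l [l0 l1 ->]] <-]|x /conv_hull2P[l [l0 l1 ->]]].
  apply/conv_hull2P; exists l; split => //.
  by apply: injective_projections; rewrite /= /GRing.scale /=; ring.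
exists ((1 - l) *: p + l *: q); first by apply/conv_hull2P; exists l.
by apply: injective_projections; rewrite /= /GRing.scale /=; ring.
Qed.

Lemma is_side_homothety D c d (k : R) (t : plane R) : k != 0 -> is_side D c d ->
  is_side [set k *: x + t | x in D] (k *: c + t) (k *: d + t).
Proof.
move=> k0 [cd [w [w0 Dw side]]]; split.
  by move=> /addIr /(scalerI k0).
have dotE x : dot (k *: w) (k *: x + t) = k ^+ 2 * dot w x + k * dot w t.
  by rewrite /dot /= /GRing.scale /=; ring.
exists (k *: w); split.
- by move=> /eqP; rewrite scaler_eq0 (negbTE k0) => /eqP.
- by move=> _ [x Dx <-]; rewrite !dotE lerD2r ler_wpM2l ?sqr_ge0 ?Dw.
rewrite -conv_hull_homothety -side; apply/seteqP; split.
  move=> _ [[x Dx <-]] /=; rewrite !dotE => /addIr /mulfI E.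
  by exists x => //; split => //=; apply: E; rewrite expf_neq0.
by move=> _ [x [Dx /= xc] <-]; split; [exists x|rewrite /= !dotE xc].
Qed.

Lemma side_ends D a b : is_side D a b ->
  exists w, [/\ w <> 0, forall x, D x -> dot w x <= dot w a, D a, D b &
    dot w b = dot w a].
Proof.
move=> [_ [w [w0 Dw side]]].
have ends x : conv_hull [:: a; b] x -> D x /\ dot w x = dot w a by rewrite -side.
have [Da _] : D a /\ dot w a = dot w a.
  by apply: ends; apply/conv_hull2P; exists 0; rewrite subr0 scale1r scale0r addr0.
have [Db ba] : D b /\ dot w b = dot w a.
  apply: ends; apply/conv_hull2P; exists 1; split => //.
  by rewrite subrr scale1r scale0r add0r.
by exists w.
Qed.

Lemma dot_eq0 u v w : det2 u v != 0 -> dot w u = 0 -> dot w v = 0 -> w = 0.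
Proof.
rewrite /det2 /dot => duv wu wv.
have E1 : w.1 * (u.1 * v.2 - u.2 * v.1) = 0.
  transitivity (v.2 * (w.1 * u.1 + w.2 * u.2) - u.2 * (w.1 * v.1 + w.2 * v.2)); first by ring.
  by rewrite wu wv !mulr0 subrr.
have E2 : w.2 * (u.1 * v.2 - u.2 * v.1) = 0.
  transitivity (u.1 * (w.1 * v.1 + w.2 * v.2) - v.1 * (w.1 * u.1 + w.2 * u.2)); first by ring.
  by rewrite wu wv !mulr0 subrr.
by apply: injective_projections; apply/eqP;
  [move/eqP: E1|move/eqP: E2]; rewrite mulf_eq0 (negbTE duv) orbF.
Qed.

Lemma parallelZ (k : R) u : parallel (k *: u) u.
Proof. by rewrite /parallel /= /GRing.scale /=; ring. Qed.

Lemma parallel_sym u v : parallel u v -> parallel v u.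
Proof. by rewrite /parallel => uv; rewrite mulrC -uv mulrC. Qed.

Lemma parallel_trans u v w : v <> 0 -> parallel u v -> parallel v w -> parallel u w.
Proof.
rewrite /parallel => v0 uv vw.
have E1 : v.1 * (u.1 * w.2 - u.2 * w.1) = 0.
  transitivity (u.1 * (v.1 * w.2 - v.2 * w.1) + w.1 * (u.1 * v.2 - u.2 * v.1)); first by ring.
  by rewrite uv vw !subrr !mulr0 addr0.
have E2 : v.2 * (u.1 * w.2 - u.2 * w.1) = 0.
  transitivity (u.2 * (v.1 * w.2 - v.2 * w.1) + w.2 * (u.1 * v.2 - u.2 * v.1)); first by ring.
  by rewrite uv vw !subrr !mulr0 addr0.
apply/eqP; rewrite -subr_eq0.
have [v1|v1] := eqVneq v.1 0; last by move/eqP: E1; rewrite mulf_eq0 (negbTE v1).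
have v2 : v.2 != 0.
  by apply/eqP => v2; apply: v0; apply: injective_projections.
by move/eqP: E2; rewrite mulf_eq0 (negbTE v2).
Qed.

(** A linear form that is not constant on any of the sides attains its maximum on
    the parallelogram in one vertex only. *)
Lemma parallelogram_side p u v a b : det2 u v != 0 ->
  is_side (conv_hull [:: p; p + u; p + u + v; p + v]) a b ->
  parallel (b - a) u \/ parallel (b - a) v.
Proof.
move=> duv side; have [w [w0 Dw Da Db ba]] := side_ends _ _ _ side.
move: Da Db => /conv_hull_squareP[a1 [a2 [a1b a2b aE]]].
move=> /conv_hull_squareP[b1 [b2 [b1b b2b bE]]].
have max (x1 x2 : R) : 0 <= x1 <= 1 -> 0 <= x2 <= 1 ->
    x1 * dot w u + x2 * dot w v <= a1 * dot w u + a2 * dot w v.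
  move=> x1b x2b; have /Dw : conv_hull [:: p; p + u; p + u + v; p + v] (p + x1 *: u + x2 *: v).
    by apply/conv_hull_squareP; exists x1, x2.
  by rewrite aE !dotDr !dotZr; lra.
have E : b1 * dot w u + b2 * dot w v = a1 * dot w u + a2 * dot w v.
  by move: ba; rewrite aE bE !dotDr !dotZr; lra.
have diff : b - a = (b1 - a1) *: u + (b2 - a2) *: v.
  by rewrite aE bE; apply: injective_projections; rewrite /= /GRing.scale /=; ring.
have [wu|wu] := eqVneq (dot w u) 0.
  left; have wv : dot w v != 0 by apply/eqP => wv; apply: w0; exact: dot_eq0 duv wu wv.
  have -> : b - a = (b1 - a1) *: u; last exact: parallelZ.
  rewrite diff; have -> : b2 = a2; last by rewrite subrr scale0r addr0.
  by apply: (mulIf wv); move: E; rewrite wu !mulr0 !add0r.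
right; have -> : b - a = (b2 - a2) *: v; last exact: parallelZ.
rewrite diff; have -> : b1 = a1; last by rewrite subrr scale0r add0r.
have max1 := max _ a2 _ a2b; have max2 := max _ b2 _ b2b; rewrite -E in max2.
have i0 : 0 <= (0 : R) <= 1 by rewrite lexx ler01.
have i1 : 0 <= (1 : R) <= 1 by rewrite lexx ler01.
have := max1 _ i0; have := max1 _ i1; have := max2 _ i0; have := max2 _ i1.
move: a1b b1b => /andP[a10 a11] /andP[b10 b11].
have /orP[wu0|wu0] : (dot w u < 0) || (0 < dot w u) by rewrite -neq_lt.
  have nil (x : R) : 0 <= x -> 0 <= x * dot w u -> x = 0.
    by move=> x0; rewrite nmulr_lge0 // => x1; apply/le_anti; rewrite x0 x1.
  move=> _ h1 _ h2; have -> : b1 = 0 by apply: nil => //; lra.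
  by apply/esym/nil => //; lra.
have one (x : R) : x <= 1 -> dot w u <= x * dot w u -> x = 1.
  by move=> x1; rewrite ler_pMl // => x0; apply/le_anti; rewrite x0 x1.
move=> h1 _ h2 _; have -> : b1 = 1 by apply: one => //; lra.
by apply/esym/one => //; lra.
Qed.

(** A point where a linear form attains its maximum [M] is, relative to [p], a
    combination of the sides at [p] whose coefficients vanish where the form
    stays below [M] if [M] is attained at [p], and have sum 1 otherwise. *)
Lemma triangle_side p q r c d : det2 (q - p) (r - p) != 0 ->
  is_side (conv_hull [:: p; q; r]) c d ->
  [\/ parallel (d - c) (q - p), parallel (d - c) (r - p) | parallel (d - c) (r - q)].
Proof.
move=> dpqr side; have [w [w0 Dw Dc Dd dc]] := side_ends _ _ _ side.
have [u uE] : exists u, u = q - p by exists (q - p).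
have [v vE] : exists v, v = r - p by exists (r - p).
rewrite -uE -vE in dpqr *.
move: Dc Dd => /conv_hull3P[c1 [c2 [c10 c20 c12 cE]]].
move=> /conv_hull3P[d1 [d2 [d10 d20 d12 dE]]].
rewrite -uE -vE in cE dE.
have max (x1 x2 : R) : 0 <= x1 -> 0 <= x2 -> x1 + x2 <= 1 ->
    x1 * dot w u + x2 * dot w v <= c1 * dot w u + c2 * dot w v.
  move=> x10 x20 x12; have /Dw : conv_hull [:: p; q; r] (p + x1 *: u + x2 *: v).
    by apply/conv_hull3P; exists x1, x2; rewrite -uE -vE.
  by rewrite cE !dotDr !dotZr; lra.
have E : d1 * dot w u + d2 * dot w v = c1 * dot w u + c2 * dot w v.
  by move: dc; rewrite cE dE !dotDr !dotZr; lra.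
have diff : d - c = (d1 - c1) *: u + (d2 - c2) *: v.
  by rewrite cE dE; apply: injective_projections; rewrite /= /GRing.scale /=; ring.
have m0 : 0 <= c1 * dot w u + c2 * dot w v.
  by have := max 0 0; rewrite !mul0r !addr0; apply; lra.
have mu : dot w u <= c1 * dot w u + c2 * dot w v.
  by have := max 1 0; rewrite mul0r mul1r !addr0; apply; lra.
have mv : dot w v <= c1 * dot w u + c2 * dot w v.
  by have := max 0 1; rewrite mul0r mul1r !add0r; apply; lra.
have [M M_E] : exists M, c1 * dot w u + c2 * dot w v = M by eexists.
rewrite M_E in E m0 mu mv.
move: m0; rewrite le_eqVlt => /predU1P[M0|M0].
  rewrite -M0 in E mu mv M_E.
  have null (x1 x2 : R) : 0 <= x1 -> 0 <= x2 ->
      x1 * dot w u + x2 * dot w v = 0 -> x1 * dot w u = 0 /\ x2 * dot w v = 0.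
    move=> x10 x20; have := mulr_ge0_le0 x10 mu; have := mulr_ge0_le0 x20 mv.
    by split; lra.
  have [cu cv] := null _ _ c10 c20 M_E; have [du dv] := null _ _ d10 d20 E.
  have [wu|wu] := eqVneq (dot w u) 0.
    have wv : dot w v != 0 by apply/eqP => wv; apply: w0; exact: dot_eq0 dpqr wu wv.
    apply: Or31; have -> : d - c = (d1 - c1) *: u; last exact: parallelZ.
    rewrite diff; have -> : d2 = c2; last by rewrite subrr scale0r addr0.
    by apply: (mulIf wv); rewrite cv dv.
  apply: Or32; have -> : d - c = (d2 - c2) *: v; last exact: parallelZ.
  rewrite diff; have -> : d1 = c1; last by rewrite subrr scale0r add0r.
  by apply: (mulIf wu); rewrite cu du.
apply: Or33.
have full (x1 x2 : R) : 0 <= x1 -> 0 <= x2 -> x1 + x2 <= 1 ->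
    x1 * dot w u + x2 * dot w v = M -> x1 = 1 - x2.
  move=> x10 x20 x12 xM; have h1 := ler_wpM2l x10 mu; have h2 := ler_wpM2l x20 mv.
  have : M * 1 <= M * (x1 + x2) by lra.
  by rewrite ler_pM2l // => ?; lra.
have c1E := full _ _ c10 c20 c12 M_E; have d1E := full _ _ d10 d20 d12 E.
have -> : d - c = (d2 - c2) *: (r - q); last exact: parallelZ.
rewrite diff c1E d1E uE vE.
by apply: injective_projections; rewrite /= /GRing.scale /=; ring.
Qed.
End Sides.

(** * Equilateral triangles with a side in a given direction *)

Section Frames.
Context {R : realType}.
Implicit Types (p q r t u v w x y : plane R).

Definition orthonormal u v := [/\ dot u u = 1, dot v v = 1 & dot u v = 0].

Lemma orthonormal_det u v : orthonormal u v -> `|det2 u v| = 1.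
Proof.
case=> uu vv uv; have : det2 u v ^+ 2 = 1.
  transitivity (dot u u * dot v v - dot u v ^+ 2); first by rewrite /det2 /dot; ring.
  by rewrite uu vv uv expr0n subr0 mulr1.
by move=> /eqP; rewrite sqrf_eq1 => /orP[] /eqP ->; rewrite ?normrN normr1.
Qed.

Lemma orthonormal_det_neq0 u v : orthonormal u v -> det2 u v != 0.
Proof. by move=> /orthonormal_det uv; rewrite -normr_eq0 uv oner_eq0. Qed.

Lemma orthonormal_expand u v x : orthonormal u v ->
  x = dot x u *: u + dot x v *: v.
Proof.
move=> uv; apply/eqP; rewrite -subr_eq0; apply/eqP.
case: (uv) => uu vv uv0.
apply: (dot_eq0 u v _ (orthonormal_det_neq0 _ _ uv)).
  transitivity (dot x u - dot x u * dot u u - dot x v * dot u v).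
    by rewrite /dot /= /GRing.scale /=; ring.
  by rewrite uu uv0; ring.
transitivity (dot x v - dot x u * dot u v - dot x v * dot v v).
  by rewrite /dot /= /GRing.scale /=; ring.
by rewrite vv uv0; ring.
Qed.

Variables (u v : plane R) (h : R).
Hypothesis uv : orthonormal u v.
Hypothesis h_gt0 : 0 < h.
Hypothesis hh : 3 * h ^+ 2 = 4.

(** The equilateral triangle with a horizontal side of length [`|k|] in the frame
    [u], [v], a vertex of that side being [t]; it points down if [k] is negative.
    The factor [1 / h] is the altitude of the triangle of side 1. *)
Definition placed (k : R) t : set (plane R) :=
  affine_frame (k *: u) ((k / h) *: v) t @` base_triangle.

Lemma placed_homothety (k l : R) t y :
  [set l *: x + y | x in placed k t] = placed (l * k) (l *: t + y).
Proof.
apply/seteqP; split => [_ [_ [b hb <-] <-]|_ [b hb <-]].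
  exists b => //; apply: injective_projections; rewrite /= /GRing.scale /=; ring.
exists (affine_frame (k *: u) ((k / h) *: v) t b); first by exists b.
by apply: injective_projections; rewrite /= /GRing.scale /=; ring.
Qed.

(** The triangle is an affine image of [half_square], with determinant
    [k ^+ 2 / h] up to sign. *)
Lemma area_placed (k : R) t : k != 0 -> area (placed k t) = (k ^+ 2 / (2 * h))%:E.
Proof.
move=> k0; have h0 : h != 0 by rewrite gt_eqF.
pose w := (k / h) *: v - (k / 2) *: u.
have dE : det2 (k *: u) w = k ^+ 2 / h * det2 u v.
  by rewrite /det2 /w /= /GRing.scale /=; field.
have d0 : det2 (k *: u) w != 0.
  by rewrite dE !mulf_neq0 ?expf_neq0 ?invr_eq0 ?orthonormal_det_neq0.
have -> : placed k t = affine_frame (k *: u) w t @` half_square.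
  apply/seteqP; split => [_ [[x y] [/= y0 xy x1] <-]|_ [[x y] [/= y0 [/= yx x1]] <-]].
    exists (x + y / 2, y); first by rewrite /half_square /=; split => //; split; lra.
    by apply: injective_projections; rewrite /= /GRing.scale /=; field.
  exists (x - y / 2, y); first by split => /=; lra.
  by apply: injective_projections; rewrite /= /GRing.scale /=; field.
have [mH aH] := @area_half_square R.
rewrite area_affine_image // aH dE normrM orthonormal_det // mulr1 -EFinM.
congr (_%:E); rewrite ger0_norm ?divr_ge0 ?sqr_ge0 ?ltW //.
by field.
Qed.

(** The third vertex has coordinates [l / 2] and [l / h] or [- l / h] relative to
    [p]. In the second case the triangle is the half-turn of one that points up,
    and [q] takes the part of the vertex [t]. *)
Lemma equilateral_placed p q r :
  0 < enorm (q - p) -> enorm (r - q) = enorm (q - p) ->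
  enorm (p - r) = enorm (q - p) -> parallel (q - p) u ->
  exists k t, k != 0 /\ conv_hull [:: p; q; r] = placed k t.
Proof.
move=> l0 rq pr par.
have dot_ge0 x : 0 <= dot x x by rewrite /dot; nra.
have enormE x : enorm x ^+ 2 = dot x x by rewrite /enorm sqr_sqrtr.
have rqE : dot (r - q) (r - q) = dot (q - p) (q - p) by rewrite -!enormE rq.
have prE : dot (p - r) (p - r) = dot (q - p) (q - p) by rewrite -!enormE pr.
have qp0 : dot (q - p) (q - p) != 0 by rewrite -enormE expf_neq0 // gt_eqF.
have [l lE] : exists l, q - p = l *: u.
  exists (dot (q - p) u); move: par; rewrite /parallel.
  have [uu _ _] := uv.
  move: (q - p) => x xu; apply: injective_projections; rewrite /= /GRing.scale /= /dot.
    transitivity (x.1 * dot u u); first by rewrite uu mulr1.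
    by have := congr1 (fun z => z * u.2) xu; rewrite /dot; lra.
  transitivity (x.2 * dot u u); first by rewrite uu mulr1.
  by have := congr1 (fun z => z * u.1) xu; rewrite /dot; lra.
have [al [be rE]] : exists al be, r - p = al *: u + be *: v.
  by exists (dot (r - p) u), (dot (r - p) v); exact: orthonormal_expand.
have dotE (x y : R) : dot (x *: u + y *: v) (x *: u + y *: v) = x ^+ 2 + y ^+ 2.
  have [uu vv uv0] := uv.
  transitivity (x ^+ 2 * dot u u + y ^+ 2 * dot v v + 2 * x * y * dot u v).
    by rewrite /dot /= /GRing.scale /=; ring.
  by rewrite uu vv uv0; ring.
have E1 : dot (q - p) (q - p) = l ^+ 2.
  by have := dotE l 0; rewrite scale0r addr0 expr0n addr0 lE.
have E2 : dot (p - r) (p - r) = al ^+ 2 + be ^+ 2.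
  rewrite -dotE -rE /dot /=; ring.
have E3 : dot (r - q) (r - q) = (al - l) ^+ 2 + be ^+ 2.
  rewrite -dotE; have -> : r - q = (r - p) - (q - p) by rewrite opprB addrA subrK.
  by rewrite rE lE scalerBl addrAC.
rewrite E1 in qp0 rqE prE; rewrite E2 in prE; rewrite E3 in rqE.
have l0' : l != 0 by apply: contraNneq qp0 => ->; rewrite expr0n.
have alE : al = l / 2.
  apply: (mulfI l0'); lra.
have h0 : h != 0 by rewrite gt_eqF.
have beE : be ^+ 2 = (l / h) ^+ 2.
  rewrite expr_div_n; apply: (mulIf (expf_neq0 2 h0)); rewrite divfK ?expf_neq0 //.
  have -> : h ^+ 2 = 4 / 3 by have := hh; lra.
  have := prE; rewrite alE; lra.
have pointE (b c : R) : p + b *: (q - p) + c *: (r - p) =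
    p + ((b + c / 2) * l) *: u + (c * be) *: v.
  by rewrite lE rE alE; apply: injective_projections; rewrite /= /GRing.scale /=; field.
move/eqP: beE; rewrite eqf_sqr => /orP[] /eqP beE.
  exists l, p; split => //; apply/seteqP; 
    split => [_ /conv_hull3P[b [c [b0 c0 bc ->]]]|_ [[x y] [/= y0 xy x1] <-]].
    exists (b + c / 2, c); first by split => /=; lra.
    by rewrite pointE beE; apply: injective_projections; rewrite /= /GRing.scale /=; field.
  apply/conv_hull3P; exists (x - y / 2), y; split; [lra|lra|lra|].
  by rewrite pointE beE; apply: injective_projections; rewrite /= /GRing.scale /=; field.
exists (- l), (p + l *: u); split; first by rewrite oppr_eq0.
apply/seteqP; split => [_ /conv_hull3P[b [c [b0 c0 bc ->]]]|_ [[x y] [/= y0 xy x1] <-]].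
  exists (1 - b - c / 2, c); first by split => /=; lra.
  by rewrite pointE beE; apply: injective_projections; rewrite /= /GRing.scale /=; field.
apply/conv_hull3P; exists (1 - x - y / 2), y; split; [lra|lra|lra|].
by rewrite pointE beE; apply: injective_projections; rewrite /= /GRing.scale /=; field.
Qed.

(** Translations and half-turns carry a triangle to any triangle with parallel
    sides of the same length: the first if both point the same way, the second
    otherwise. *)
Lemma move_placed (k l : R) t y : l = k \/ l = - k ->
  exists f, translation_or_half_turn f /\ f @` placed k t = placed l y.
Proof.
case=> ->.
  exists (fun x => x + (y - t)); split; first by left; exists (y - t).
  have := placed_homothety k 1 t (y - t).
  rewrite mul1r scale1r [t + _]addrC subrK => <-.
  by congr (_ @` _); apply/funext => x; rewrite scale1r.
exists (fun x => (2^-1 *: (y + t)) *+ 2 - x); split.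
  by right; exists (2^-1 *: (y + t)).
have := placed_homothety k (-1) t (y + t).
rewrite mulN1r scaleN1r [- t + _]addrC addrK => <-.
congr (_ @` _); apply/funext => x.
by apply: injective_projections; rewrite /= /GRing.scale /= ?mulr2n; field.
Qed.

End Frames.

(** * Packing the unit square *)

Section Packing.
Context {R : realType}.
Variables (u v p : plane R) (h : R).
Hypothesis uv : orthonormal u v.
Hypothesis h_gt0 : 0 < h.
Hypothesis hh : 3 * h ^+ 2 = 4.

Local Notation square := (conv_hull [:: p; p + u; p + u + v; p + v]).

Lemma placed_affine_frame (k : R) (c b : plane R) :
  affine_frame (k *: u) ((k / h) *: v) (affine_frame u (h^-1 *: v) p c) b =
  affine_frame u (h^-1 *: v) p (homothety k c b).
Proof. by apply: injective_projections; rewrite /= /GRing.scale /=; ring. Qed.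

(** The triangles are enumerated by decreasing size, and each of them is carried
    to the place that [packing_of_sequence] provides for its rank. *)
Lemma placed_packing (N : set nat) (T : nat -> set (plane R))
    (k : nat -> R) (t : nat -> plane R) :
  (forall n, N n -> k n != 0 /\ T n = placed u v h (k n) (t n)) ->
  (forall r : seq nat, uniq r -> {in r, forall n, N n} ->
    \sum_(n <- r) k n ^+ 2 <= 1) ->
  exists f, packing square N T f /\
    forall n, N n -> exists l y, l != 0 /\ f n @` T n = placed u v h l y.
Proof.
move=> TE sum_le1; pose s n := `|k n|.
have s0 n : N n -> 0 < s n by move=> /TE[k0 _]; rewrite normr_gt0.
have sS r : uniq r -> {in r, forall n, N n} -> \sum_(n <- r) s n ^+ 2 <= 1.
  move=> ur rN; rewrite (eq_bigr (fun n => k n ^+ 2)); first exact: sum_le1.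
  by move=> n _; rewrite /s real_normK ?num_real.
have [rank [sigma [rank_inj sigmaE sigma_dec sigma_sum]]] :=
  decreasing_enumeration N s s0 sS.
have [l [c [lE inside separated]]] := packing_of_sequence h sigma h_gt0 hh
  (fun n => (sigma_dec n).1) (fun n => (sigma_dec n).2) sigma_sum.
pose Phi : plane R -> plane R := affine_frame u (h^-1 *: v) p.
have /choice[f fP] : forall n, exists f, N n -> translation_or_half_turn f /\
    f @` T n = placed u v h (l (rank n)) (Phi (c (rank n))).
  move=> n; have [Nn|] := pselect (N n); last by exists id.
  have [k0 ->] := TE n Nn.
  have lk : l (rank n) = k n \/ l (rank n) = - k n.
    case: (lE (rank n)) => ->; rewrite sigmaE // /s; case: (ger0P (k n)) => _;
      rewrite ?opprK; first [by left|by right].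
  by have [f Hf] := move_placed u v h (k n) (l (rank n)) (t n) (Phi (c (rank n))) lk; exists f.
have pointP n x : N n -> (f n @` T n) x -> exists2 b, base_triangle b &
    x = Phi (homothety (l (rank n)) (c (rank n)) b).
  move=> /fP[_ ->] [b hb <-]; exists b => //; exact: placed_affine_frame.
exists f; split; last first.
  move=> n Nn; have [_ fE] := fP n Nn; exists (l (rank n)), (Phi (c (rank n))).
  split => //; have [k0 _] := TE n Nn.
  by case: (lE (rank n)) => ->; rewrite ?oppr_eq0 sigmaE // normr_eq0.
split.
- by move=> n /fP[].
- move=> n Nn _ /(pointP n _ Nn)[b hb ->].
  have [z10 z11 z20 z2h] := inside (rank n) b hb.
  apply/conv_hull_squareP; move: z10 z11 z20 z2h.
  set z := homothety _ _ _ => z10 z11 z20 z2h; exists z.1, (z.2 / h); split; first by rewrite z10.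
    by rewrite ler_pdivrMr // mul1r z2h divr_ge0 // ltW.
  by apply: injective_projections; rewrite /= /GRing.scale /=; ring.
have apart m n : N m -> N n -> (rank m < rank n)%N ->
    interior (f m @` T m) `&` interior (f n @` T n) = set0.
  move=> Nm Nn /separated[w [g [w0 wg]]].
  pose W : plane R := w.1 *: u + (h * w.2) *: v.
  have [uu vv uv0] := uv; have h0 : h != 0 by rewrite gt_eqF.
  have WE z : dot W (Phi z) = w.1 * z.1 + w.2 * z.2 + dot W p.
    transitivity (w.1 * z.1 * dot u u + w.2 * z.2 * dot v v
        + (w.1 * z.2 / h + h * w.2 * z.1) * dot u v + dot W p).
      by rewrite /dot /W /= /GRing.scale /=; field.
    by rewrite uu vv uv0; ring.
  apply: (interior_disjoint W (g + dot W p)).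
  - move=> W0; apply: w0; apply: injective_projections => /=.
      transitivity (dot W u); last by rewrite W0 /dot /=; ring.
      transitivity (w.1 * dot u u + h * w.2 * dot u v); first by rewrite uu uv0; ring.
      by rewrite /dot /W /= /GRing.scale /=; ring.
    apply: (mulfI h0); transitivity (dot W v); last by rewrite W0 /dot /=; ring.
    transitivity (w.1 * dot u v + h * w.2 * dot v v); first by rewrite vv uv0; ring.
    by rewrite /dot /W /= /GRing.scale /=; ring.
  - move=> x /(pointP m _ Nm)[b hb ->]; rewrite WE lerD2r.
    (* [wg] bounds two triangles at once and needs a point of each *)
    have b0 : base_triangle ((0, 0) : plane R) by split => /=; lra.
    exact: (wg b (0, 0) hb b0).1.
  - move=> x /(pointP n _ Nn)[b hb ->]; rewrite WE lerD2r.
    have b0 : base_triangle ((0, 0) : plane R) by split => /=; lra.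
    exact: (wg (0, 0) b b0 hb).2.
move=> m n Nm Nn mn.
case: (ltngtP (rank m) (rank n)) => [|nm|/rank_inj E]; first exact: apart.
  by rewrite setIC; exact: apart.
by case: mn; exact: E.
Qed.

End Packing.

(** The height of the unit square in units of the altitude of a triangle of side
    1; the area of that triangle is [(2 * h)^-1]. *)
Lemma sqrt3_height {R : realType} :
  exists h : R, [/\ 0 < h, 3 * h ^+ 2 = 4 & Num.sqrt 3 / 4 = (2 * h)^-1].
Proof.
have s3 : (Num.sqrt 3 : R) ^+ 2 = 3 by rewrite sqr_sqrtr.
have s0 : 0 < (Num.sqrt 3 : R) by rewrite sqrtr_gt0.
have s0' : (Num.sqrt 3 : R) != 0 by rewrite gt_eqF.
exists (2 / Num.sqrt 3); split; first exact: divr_gt0.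
  by rewrite expr_div_n s3; field.
by field.
Qed.

(** After possibly exchanging the two axes, the base of the square is parallel
    to the first one. *)
Lemma square_frame {R : realType} (I : set (plane R)) a b :
  unit_square I -> is_side I a b ->
  exists p u v, [/\ orthonormal u v, parallel (b - a) u &
    I = conv_hull [:: p; p + u; p + u + v; p + v]].
Proof.
move=> [p [u [v [eu ev uv IE]]]] hab.
have enorm1 x : enorm x = 1 -> dot x x = 1.
  move=> x1; have x0 : 0 <= dot x x by rewrite /dot; nra.
  by rewrite -(sqr_sqrtr x0) -/(enorm x) x1 expr1n.
have uvP : orthonormal u v by split => //; exact: enorm1.
have [par|par] : parallel (b - a) u \/ parallel (b - a) v.
- by apply: (parallelogram_side p); rewrite ?orthonormal_det_neq0 // -IE.
- by exists p, u, v.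
exists p, v, u; split => //.
  by case: uvP => ? ? ?; split => //; rewrite -uv /dot; ring.
rewrite IE; apply/seteqP; split => x /conv_hull_squareP[y [z [y01 z01 ->]]];
  apply/conv_hull_squareP; exists z, y; split => //; by rewrite addrAC.
Qed.

Lemma conv_hull_rotate {R : realType} (p q r : plane R) :
  conv_hull [:: p; q; r] = conv_hull [:: q; r; p].
Proof.
have rotate (a b c : plane R) : conv_hull [:: a; b; c] `<=` conv_hull [:: b; c; a].
  move=> _ /conv_hull3P[y [z [y0 z0 yz ->]]].
  apply/conv_hull3P; exists z, (1 - (y + z)); split; [lra|lra|lra|].
  by apply: injective_projections; rewrite /= /GRing.scale /=; ring.
by apply/seteqP; split => x; [exact: rotate|move=> /rotate/rotate].
Qed.

(** By [triangle_side] the given side is parallel to one of the three edges; a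
    cyclic permutation of the vertices makes it the first one. *)
Lemma triangle_frame {R : realType} (Delta : set (plane R)) c d u v h :
  orthonormal u v -> 0 < h -> 3 * h ^+ 2 = 4 ->
  equilateral_triangle Delta -> is_side Delta c d -> parallel (d - c) u ->
  exists k t, k != 0 /\ Delta = placed u v h k t.
Proof.
move=> uv h0 hh [p [q [r [l0 rq pr DE]]]] side par.
have cd : d - c <> 0 by case: side => cd _ /eqP; rewrite subr_eq0 => /eqP/esym.
have enormE x : enorm x ^+ 2 = dot x x by rewrite /enorm sqr_sqrtr // /dot; nra.
have nondegenerate : det2 (q - p) (r - p) != 0.
  have E1 : dot (r - q) (r - q) = dot (q - p) (q - p) by rewrite -!enormE rq.
  have E2 : dot (p - r) (p - r) = dot (q - p) (q - p) by rewrite -!enormE pr.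
  have l2 : 0 < dot (q - p) (q - p) by rewrite -enormE exprn_gt0.
  have E3 : dot (q - p) (r - p) = dot (q - p) (q - p) / 2.
    by move: E1 E2; rewrite /dot /=; lra.
  apply/eqP => d0.
  have : dot (q - p) (q - p) * dot (p - r) (p - r) =
      det2 (q - p) (r - p) ^+ 2 + dot (q - p) (r - p) ^+ 2.
    by rewrite /det2 /dot /=; ring.
  by rewrite d0 E2 E3; have := mulr_gt0 l2 l2; lra.
have along x : parallel (d - c) x -> parallel x u.
  by move=> dx; apply: parallel_trans cd _ par; exact: parallel_sym.
rewrite DE in side *.
have [/along qpu|/along rpu|/along rqu] := triangle_side _ _ _ _ _ nondegenerate side.
- exact: (equilateral_placed u v h uv h0 hh).
- rewrite 2!conv_hull_rotate; apply: (equilateral_placed u v h uv h0 hh);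
    rewrite ?rq ?pr //.
  by rewrite -opprB -scaleN1r; move: rpu; rewrite /parallel /= /GRing.scale /=; lra.
- rewrite conv_hull_rotate; apply: (equilateral_placed u v h uv h0 hh);
    by rewrite ?rq ?pr.
Qed.

Lemma sum_le_esum {R : realType} (N : set nat) (a : nat -> \bar R) (r : seq nat) :
  uniq r -> {in r, forall n, N n} ->
  (\sum_(n <- r) a n <= \esum_(n in N) a n)%E.
Proof.
move=> ur rN; apply: esum_ge; exists [set` r]; last by rewrite fsbig_seq.
by split => //= n; exact: rN.
Qed.

Lemma square_width {R : realType} (p u v x : plane R) : orthonormal u v ->
  conv_hull [:: p; p + u; p + u + v; p + v] x ->
  dot p u <= dot x u <= dot p u + 1.
Proof.
move=> [uu _ uv] /conv_hull_squareP[b [c [/andP[b0 b1] _ ->]]].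
have -> : dot (p + b *: u + c *: v) u = dot p u + b * dot u u + c * dot u v.
  by rewrite /dot /= /GRing.scale /=; ring.
by rewrite uu uv; apply/andP; split; lra.
Qed.

Theorem theorem2 (R : realType) (I Delta : set (plane R)) (a b c d : plane R)
  (hI : unit_square I) (hDelta : equilateral_triangle Delta)
  (hab : is_side I a b) (hcd : is_side Delta c d)
  (hpar : parallel (d - c) (b - a)) :
  (forall (N : set nat) (T : nat -> set (plane R)),
     (forall n, N n -> homothetic_copy Delta (T n)) ->
     (\esum_(n in N) area (T n) <= (Num.sqrt 3 / 4)%:E)%E ->
     parallel_packable I a b N T) /\
  is_rho I a b Delta (Num.sqrt 3 / 4).
Proof.
have [h [h0 hh hE]] := @sqrt3_height R.
have [p [u [v [uv bau IE]]]] := square_frame _ _ _ hI hab.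
have ba0 : b - a <> 0 by case: hab => ab _ /eqP; rewrite subr_eq0 => /eqP/esym.
have [k0 [t0 [k00 DE]]] := triangle_frame _ _ _ _ _ _ uv h0 hh hDelta hcd
  (parallel_trans _ _ _ ba0 hpar bau).
have areaI : area I = 1%E.
  by rewrite IE area_parallelogram ?orthonormal_det_neq0 // orthonormal_det.
have copyE k t : placed u v h k t =
    [set (k / k0) *: x + (t - (k / k0) *: t0) | x in Delta].
  by rewrite DE placed_homothety divfK // addrCA subrr addr0.
have packs (N : set nat) (T : nat -> set (plane R)) :
    (forall n, N n -> homothetic_copy Delta (T n)) ->
    (\esum_(n in N) area (T n) <= (Num.sqrt 3 / 4)%:E)%E ->
    parallel_packable I a b N T.
  move=> TD sumT.
  have /choice[kt ktP] : forall n, exists kt : R * plane R,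
      N n -> kt.1 != 0 /\ T n = placed u v h kt.1 kt.2.
    move=> n; have [Nn|] := pselect (N n); last by exists (0, 0).
    have [k [t [kn0 TE]]] := TD n Nn.
    exists (k * k0, k *: t0 + t) => _; rewrite mulf_neq0 //; last exact/eqP.
    by rewrite TE DE placed_homothety.
  have [|f [fpack fplaced]] := placed_packing u v p h uv h0 hh N T
      (fun n => (kt n).1) (fun n => (kt n).2) ktP.
    move=> r ur rN; have := le_trans (sum_le_esum N _ r ur rN) sumT.
    rewrite (eq_big_seq (fun n => ((kt n).1 ^+ 2 / (2 * h))%:E)); last first.
      by move=> n /rN/ktP[kn0 ->]; rewrite area_placed.
    by rewrite sumEFin lee_fin hE -mulr_suml ler_pdivrMr ?mulVf ?mulr_gt0 ?mulf_neq0 ?gt_eqF.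
  exists f; rewrite IE; split => // n /fplaced[l [y [l0 fE]]].
  exists ((l / k0) *: c + (y - (l / k0) *: t0)).
  exists ((l / k0) *: d + (y - (l / k0) *: t0)); split.
    rewrite fE copyE; apply: is_side_homothety => //.
    by rewrite mulf_neq0 ?invr_eq0.
  rewrite opprD addrACA subrr addr0 -scalerBr.
  by move: hpar; rewrite /parallel /= /GRing.scale /= -!mulrA => ->.
split => //; split => [N T TD|r guarantee].
  by rewrite areaI mule1; exact: packs.
(* a single triangle of area [r] has a side longer than 1 along the base *)
rewrite leNgt; apply/negP => r_gt.
have r0 : 0 < r by apply: le_lt_trans r_gt; rewrite divr_ge0 ?sqrtr_ge0.
pose s := Num.sqrt (2 * h * r).
have s2 : s ^+ 2 = 2 * h * r by rewrite sqr_sqrtr // !mulr_ge0 // ltW.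
have s1 : 1 < s.
  rewrite -(@ltr_pXn2r _ 2) // ?nnegrE ?sqrtr_ge0 // expr1n s2.
  by rewrite mulrC -ltr_pdivrMr ?mulr_gt0 // mul1r -hE.
have s0 : s != 0 by rewrite gt_eqF // (lt_trans ltr01).
have aE : area (placed u v h s 0) = r%:E.
  by rewrite area_placed // s2 mulrAC divff ?mul1r // mulf_neq0 // gt_eqF.
have [] := guarantee [set 0%N] (fun=> placed u v h s 0).
- move=> n _; exists (s / k0), (0 - (s / k0) *: t0); split; last exact: copyE.
  by apply/eqP; rewrite mulf_neq0 ?invr_eq0.
- by rewrite areaI mule1 esum_set1 aE // lee_fin ltW.
move=> f [[rigid inside _] _].
have vertex (e : R) : (e = 0) \/ (e = 1) -> I (f 0%N ((e * s) *: u)).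
  move=> e01; apply: (inside 0%N erefl); exists ((e * s) *: u) => //.
  exists (e, 0); first by case: e01 => ->; split => /=; lra.
  by apply: injective_projections; rewrite /= /GRing.scale /=; ring.
have := vertex 0 (or_introl erefl); have := vertex 1 (or_intror erefl).
rewrite IE => /(square_width _ _ _ _ uv)/andP[l1 g1] /(square_width _ _ _ _ uv)/andP[l2 g2].
have [uu _ _] := uv.
have step :
    dot (f 0%N ((1 * s) *: u)) u = dot (f 0%N ((0 * s) *: u)) u + s * dot u u \/
    dot (f 0%N ((1 * s) *: u)) u = dot (f 0%N ((0 * s) *: u)) u - s * dot u u.
  by case: (rigid 0%N erefl) => [[t ->]|[q ->]]; [left|right];
    rewrite /dot /= /GRing.scale /=; ring.
by rewrite uu mulr1 in step; case: step => E; rewrite E in l1 g1; lra.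
Qed.
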